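(* Let $r,k,e,i$ be fixed integers satisfying $i\ge 0$, $r\ge k+i+1\ge 2$ and $\binom{k+i+1}{k}\ge e\ge 3$. Then $f_r(n,e(r-k)+k+i+1,e)=o(n^k)$ as $n\to\infty$.
   Context: For integers $r,v,e$, an $r$-uniform hypergraph is called $\mathcal{G}_r(v,e)$-free if it does not contain $e$ distinct edges whose union has at most $v$ vertices (equivalently, the union of any $e$ distinct edges has at least $v+1$ vertices). $f_r(n,v,e)$ denotes the maximum number of edges in a $\mathcal{G}_r(v,e)$-free $r$-uniform hypergraph on $n$ vertices. *)

(* Defs.v *)
From mathcomp Require Import all_boot.

Set Implicit Arguments.
Unset Strict Implicit.
Unset Printing Implicit Defensive.

(* A hypergraph on the vertex set V is its set of (pairwise distinct) edges. *)

Definition uniform_hypergraph (V : finType) (r : nat) (H : {set {set V}}) :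
    bool :=
  [forall A in H, #|A| == r].

Definition G_free (V : finType) (v e : nat) (H : {set {set V}}) : bool :=
  ~~ [exists E : {set {set V}}, [&& E \subset H, #|E| == e & #|cover E| <= v]].

(* For e > 0 the family over which the maximum is taken contains the empty
   hypergraph, so this is a genuine maximum; for e = 0 no hypergraph is
   G_free and the value is the default 0. *)
Definition f_max (r n v e : nat) : nat :=
  \max_(H : {set {set 'I_n}} | uniform_hypergraph r H && G_free v e H) #|H|.

(* Main.v *)
Require Import Defs.
From HB Require Import structures.
From mathcomp Require Import all_boot all_order all_algebra.
From mathcomp Require Import ring lra zify.
From mathcomp Require boolp.
Import Order.TTheory GRing.Theory Num.Theory.

(** Edges meeting in at least k vertices cluster: e of them around one edge would
span at most e(r-k)+k vertices, so a positive fraction of the edges can be kept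
with pairwise intersections of size < k.  Put t = k+i+1, label t vertices of each
remaining edge and colour a k-tuple of vertices by whether it occurs, in the right
places, in some edge.  If there are c n^k edges, the t-tuples coming from the edges
have pairwise distinct k-subtuples, so they cannot all be destroyed by deleting
few k-tuples; by the removal lemma there are at least delta n^t t-tuples all of
whose k-subtuples occur.  Only O(n^(t-1)) of these use one edge for two k-subtuples,
so some t-tuple has C(t,k) >= e distinct covering edges, and e of them span at most
t + e(r-k) vertices, which was forbidden.

The removal lemma is deduced from a counting statement, proved by induction on the
dimension d of the coloured faces: after a refinement of the lower-dimensional
colours and outside a small set of tuples, the probability that a random
configuration of any bounded shape has the colours of a given tuple is, up to a
small relative error, the product of numbers attached to its faces.  In the
inductive step the indicator of a colour class of (d+1)-faces is split as density
on a coarse partition + L2-small + quasirandom with respect to a much finer one.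
The quasirandom part averages out; the L2-small part is controlled, relative to
the possibly tiny cell, by Cauchy-Schwarz and by counting the shape doubled along
the face. *)

Set Implicit Arguments.
Unset Strict Implicit.
Unset Printing Implicit Defensive.
Local Open Scope ring_scope.

(** * Averages and conditional expectations *)

Section Average.
Variable R : archiRealFieldType.
Implicit Type T : finType.

Definition avg T (f : T -> R) : R := (\sum_x f x) / #|T|%:R.

Lemma eq_avg T (f g : T -> R) : f =1 g -> avg f = avg g.
Proof. by move=> fg; rewrite /avg (eq_bigr _ (fun x _ => fg x)). Qed.

Lemma avgD T (f g : T -> R) : avg (fun x => f x + g x) = avg f + avg g.
Proof. by rewrite /avg big_split mulrDl. Qed.

Lemma avgN T (f : T -> R) : avg (fun x => - f x) = - avg f.
Proof. by rewrite /avg sumrN mulNr. Qed.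

Lemma avgB T (f g : T -> R) : avg (fun x => f x - g x) = avg f - avg g.
Proof. by rewrite avgD avgN. Qed.

Lemma avgZ T c (f : T -> R) : avg (fun x => c * f x) = c * avg f.
Proof. by rewrite /avg -mulr_sumr mulrA. Qed.

Lemma avg_sum T I (r : seq I) (P : pred I) (F : I -> T -> R) :
  avg (fun x => \sum_(i <- r | P i) F i x) = \sum_(i <- r | P i) avg (F i).
Proof. by rewrite /avg exchange_big mulr_suml. Qed.

Lemma ler_avg T (f g : T -> R) : (forall x, f x <= g x) -> avg f <= avg g.
Proof.
move=> fg; rewrite /avg ler_wpM2r ?invr_ge0 ?ler0n //.
by apply: ler_sum => x _.
Qed.

Lemma avg_ge0 T (f : T -> R) : (forall x, 0 <= f x) -> 0 <= avg f.
Proof. by move=> f0; rewrite /avg divr_ge0 ?ler0n ?sumr_ge0. Qed.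

Lemma avg_cst T (c : R) : (0 < #|T|)%N -> avg (fun _ : T => c) = c.
Proof.
by move=> T0; rewrite /avg sumr_const -(mulr_natr c) mulfK // pnatr_eq0 -lt0n.
Qed.

Lemma avg_cst_le T (c : R) : 0 <= c -> avg (fun _ : T => c) <= c.
Proof.
move=> c0; case: (posnP #|T|) => [T0|T0]; last by rewrite avg_cst.
by rewrite /avg T0 invr0 mulr0.
Qed.

Lemma ler_avg_cst T (f : T -> R) c :
  0 <= c -> (forall x, f x <= c) -> avg f <= c.
Proof. by move=> c0 fc; apply: le_trans (ler_avg fc) (avg_cst_le _ c0). Qed.

Lemma ler_norm_avg T (f : T -> R) : `|avg f| <= avg (fun x => `|f x|).
Proof.
rewrite /avg normrM [X in _ * X]ger0_norm ?invr_ge0 ?ler0n //.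
by rewrite ler_wpM2r ?invr_ge0 ?ler0n // ler_norm_sum.
Qed.

Lemma avg_pair T1 T2 (f : T1 -> T2 -> R) :
  avg (fun x => avg (f x)) = avg (fun p : T1 * T2 => f p.1 p.2).
Proof.
rewrite /avg -mulr_suml -(pair_bigA _ f) /= card_prod natrM invfM.
by rewrite -mulrA; congr (_ * _); rewrite mulrC.
Qed.

Lemma avg_exchange T1 T2 (f : T1 -> T2 -> R) :
  avg (fun x => avg (f x)) = avg (fun y => avg (f ^~ y)).
Proof.
rewrite /avg -!mulr_suml exchange_big /= -!mulrA; congr (_ * _).
by rewrite mulrC.
Qed.

Lemma avg_bij T1 T2 (g : T1 -> T2) (f : T2 -> R) :
  bijective g -> avg f = avg (fun x => f (g x)).
Proof.
move=> bg; rewrite /avg (bij_eq_card bg); congr (_ / _).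
by rewrite (reindex g) //; apply: onW_bij.
Qed.

(** Lagrange's identity: the double average of [(f x * g y - f y * g x) ^+ 2] is nonnegative and
    equals twice the difference of the two sides. *)
Lemma avg_CauchySchwarz T (f g : T -> R) :
  avg (fun x => f x * g x) ^+ 2
    <= avg (fun x => f x ^+ 2) * avg (fun x => g x ^+ 2).
Proof.
set A := avg (fun x => f x ^+ 2); set B := avg (fun x => g x ^+ 2).
set C := avg _.
have : 0 <= avg (fun x => avg (fun y => (f x * g y - f y * g x) ^+ 2)).
  by apply: avg_ge0 => x; apply: avg_ge0 => y; exact: sqr_ge0.
have -> : avg (fun x => avg (fun y => (f x * g y - f y * g x) ^+ 2))
        = avg (fun x => B * f x ^+ 2 - (2 * C) * (f x * g x) + A * g x ^+ 2).
  apply: eq_avg => x.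
  transitivity (avg (fun y => f x ^+ 2 * g y ^+ 2
    - (2 * (f x * g x)) * (f y * g y) + g x ^+ 2 * f y ^+ 2)).
    by apply: eq_avg => y; ring.
  by rewrite avgD avgB !avgZ -/A -/B -/C; ring.
rewrite avgD avgB !avgZ -/A -/B -/C; nra.
Qed.

Lemma natr_and (a b : bool) : (a && b)%:R = a%:R * b%:R :> R.
Proof. by case: a; case: b; rewrite ?mulr0 ?mulr1. Qed.

End Average.

Section ConditionalExpectation.
Variables (R : archiRealFieldType) (T : finType).
Implicit Types (K : eqType) (f g : T -> R).

(** Conditional expectation given the partition into fibres of [key]. The fibre of [x] contains [x],
    so the denominator never vanishes. *)
Definition cexp K (key : T -> K) f x : R :=
  (\sum_(y | key y == key x) f y) / #|[pred y | key y == key x]|%:R.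

Lemma fiber_gt0 K (key : T -> K) x :
  0 < #|[pred y | key y == key x]|%:R :> R.
Proof. by rewrite ltr0n; apply/card_gt0P; exists x; rewrite inE. Qed.

Lemma cexp_key K (key : T -> K) f x y :
  key x = key y -> cexp key f x = cexp key f y.
Proof. by rewrite /cexp => ->. Qed.

Lemma cexp_id K (key : T -> K) f :
  (forall x y, key x = key y -> f x = f y) -> cexp key f =1 f.
Proof.
move=> fk x; rewrite /cexp (eq_bigr (fun _ => f x)) => [|y /eqP/fk //].
by rewrite sumr_const -(mulr_natr (f x)) mulfK // gt_eqF ?fiber_gt0.
Qed.

Lemma cexp_ge0 K (key : T -> K) f x : (forall y, 0 <= f y) -> 0 <= cexp key f x.
Proof. by move=> f0; rewrite divr_ge0 ?ler0n ?sumr_ge0. Qed.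

Lemma cexp_le1 K (key : T -> K) f x : (forall y, f y <= 1) -> cexp key f x <= 1.
Proof.
move=> f1; rewrite ler_pdivrMr ?fiber_gt0 // mul1r.
by rewrite (le_trans (ler_sum _ (fun y _ => f1 y))) // sumr_const.
Qed.

(** Self-adjointness: both sides sum [f y * g x], divided by the fibre size, over the pairs in a
    common fibre. *)
Lemma avg_cexpA K (key : T -> K) f g :
  avg (fun x => cexp key f x * g x) = avg (fun x => f x * cexp key g x).
Proof.
rewrite /avg; congr (_ / _).
under eq_bigr do rewrite /cexp -mulrA mulr_suml.
under [RHS]eq_bigr do rewrite /cexp mulrA mulr_sumr mulr_suml.
under eq_bigr do rewrite big_mkcond.
under [RHS]eq_bigr do rewrite big_mkcond.
rewrite exchange_big /=; apply: eq_bigr => y _; apply: eq_bigr => x _.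
rewrite eq_sym; case: eqP => // -> ; by rewrite mulrA mulrAC.
Qed.

Lemma avg_cexpM K (key : T -> K) f g :
  (forall x y, key x = key y -> g x = g y) ->
  avg (fun x => cexp key f x * g x) = avg (fun x => f x * g x).
Proof.
by move=> gk; rewrite avg_cexpA; apply: eq_avg => x; rewrite (cexp_id gk).
Qed.

Lemma avg_cexp K (key : T -> K) f : avg (cexp key f) = avg f.
Proof.
transitivity (avg (fun x => cexp key f x * 1)).
  by apply: eq_avg => x; rewrite mulr1.
by rewrite avg_cexpM //; apply: eq_avg => x; rewrite mulr1.
Qed.

(** Pythagoras: the coarse conditional expectation is the orthogonal projection of the fine one. *)
Lemma avg_cexp_sqrB K K' (key : T -> K) (key' : T -> K') f :
  (forall x y, key' x = key' y -> key x = key y) ->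
  avg (fun x => (cexp key' f x - cexp key f x) ^+ 2) =
  avg (fun x => cexp key' f x ^+ 2) - avg (fun x => cexp key f x ^+ 2).
Proof.
move=> kk.
have e1 : avg (fun x => cexp key' f x * cexp key f x)
        = avg (fun x => cexp key f x ^+ 2).
  rewrite avg_cexpM => [|x y /kk/cexp_key->//].
  rewrite -(@avg_cexpM _ key) => [|x y /cexp_key->//].
  by apply: eq_avg => x; rewrite expr2.
transitivity (avg (fun x => cexp key' f x ^+ 2
   - 2 * (cexp key' f x * cexp key f x) + cexp key f x ^+ 2)).
  by apply: eq_avg => x; ring.
by rewrite avgD avgB avgZ e1; ring.
Qed.

(** A test constant on the fine fibres cannot distinguish [f] from its fine conditional expectation.
    Its correlation with the deviation of [f] from the coarse one therefore forces an energy gain,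
    by Cauchy-Schwarz and Pythagoras. *)
Lemma cexp_increment K K' (key : T -> K) (key' : T -> K') f (w : T -> bool) :
  (forall x y, key' x = key' y -> key x = key y) ->
  (forall x y, key' x = key' y -> w x = w y) ->
  avg (fun x => (f x - cexp key f x) * (w x)%:R) ^+ 2 <=
  avg (fun x => cexp key' f x ^+ 2) - avg (fun x => cexp key f x ^+ 2).
Proof.
move=> kk kw; rewrite -avg_cexp_sqrB //.
have -> : avg (fun x => (f x - cexp key f x) * (w x)%:R)
  = avg (fun x => (cexp key' f x - cexp key f x) * (w x)%:R).
  transitivity (avg (fun x => f x * (w x)%:R - cexp key f x * (w x)%:R)).
    by apply: eq_avg => x; rewrite mulrBl.
  rewrite avgB -(@avg_cexpM _ key' f) => [|x y /kw->//]; rewrite -avgB.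
  by apply: eq_avg => x; rewrite mulrBl.
apply: le_trans (avg_CauchySchwarz _ _) _; rewrite ler_piMr //.
  by apply: avg_ge0 => x; exact: sqr_ge0.
by apply: ler_avg_cst => // x; case: (w x); rewrite ?expr1n ?expr0n.
Qed.

End ConditionalExpectation.

(** * Regularity by energy increment *)

Section Regularity.
Variables (R : archiRealFieldType) (t : nat).
Implicit Types (V : finType) (h f : {set 'I_t}).

(** Colours of faces of all sizes are kept as functions on the one space of [t]-tuples, so that
    averages never change their domain; locality records the face a function belongs to. *)
Definition local V (A : Type) h (u : {ffun 'I_t -> V} -> A) :=
  forall x y : {ffun 'I_t -> V}, {in h, x =1 y} -> u x = u y.

Definition boundary_key V d (P : {set 'I_t} -> {ffun 'I_t -> V} -> nat) h x :
    {ffun {set 'I_t} -> nat} :=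
  [ffun f : {set 'I_t} => if (f \subset h) && (#|f| == d) then P f x else 0%N].

Lemma boundary_keyP V d (P : {set 'I_t} -> {ffun 'I_t -> V} -> nat) h x y :
  boundary_key d P h x = boundary_key d P h y <->
  (forall f, f \subset h -> #|f| = d -> P f x = P f y).
Proof.
split=> [/ffunP e f fh fd|e].
  by have := e f; rewrite !ffunE fh fd eqxx.
apply/ffunP => f; rewrite !ffunE.
by case: andP => // -[fh /eqP fd]; exact: e.
Qed.

Definition indic V (Q : {set 'I_t} -> {ffun 'I_t -> V} -> nat) h c x : R :=
  (Q h x == c)%:R.

Definition density V d (Q P : {set 'I_t} -> {ffun 'I_t -> V} -> nat) h c :
    {ffun 'I_t -> V} -> R :=
  cexp (boundary_key d P h) (indic Q h c).

Lemma density_local V d (Q P : {set 'I_t} -> {ffun 'I_t -> V} -> nat) h c :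
  (forall f, local f (P f)) -> local h (density d Q P h c).
Proof.
move=> lP x y xy; apply: cexp_key; apply/boundary_keyP => f fh _.
by apply: lP => j jf; apply: xy; exact: (subsetP fh).
Qed.

Lemma density_ge0 V d (Q P : {set 'I_t} -> {ffun 'I_t -> V} -> nat) h c x :
  0 <= density d Q P h c x.
Proof. by apply: cexp_ge0 => y; rewrite ler0n. Qed.

Lemma density_le1 V d (Q P : {set 'I_t} -> {ffun 'I_t -> V} -> nat) h c x :
  density d Q P h c x <= 1.
Proof. by apply: cexp_le1 => y; rewrite /indic lern1 leq_b1. Qed.

Definition boundary_test V d (U : {set 'I_t} -> {ffun 'I_t -> V} -> bool) h x :=
  [forall f : {set 'I_t}, (f \subset h) && (#|f| == d) ==> U f x].

(** Quasirandomness: the deviation from the density is nearly orthogonal to every intersection of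
    events living on the [d]-subsets of [h]. *)
Definition regular V d m (eta : R)
    (Q P : {set 'I_t} -> {ffun 'I_t -> V} -> nat) :=
  forall h c U, (c < m)%N -> (forall f, local f (U f)) ->
  `|avg (fun x => (indic Q h c x - density d Q P h c x)
                  * (boundary_test d U h x)%:R)| <= eta.

Definition energy V d m (Q P : {set 'I_t} -> {ffun 'I_t -> V} -> nat) : R :=
  \sum_(h : {set 'I_t}) \sum_(c < m) avg (fun x => density d Q P h c x ^+ 2).

Lemma energy_ge0 V d m (Q P : {set 'I_t} -> {ffun 'I_t -> V} -> nat) :
  0 <= energy d m Q P.
Proof.
apply: sumr_ge0 => h _; apply: sumr_ge0 => c _.
by apply: avg_ge0 => x; exact: sqr_ge0.
Qed.

Lemma energy_le V d m (Q P : {set 'I_t} -> {ffun 'I_t -> V} -> nat) :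
  energy d m Q P <= (#|{set 'I_t}| * m)%:R.
Proof.
apply: le_trans (_ : \sum_(h : {set 'I_t}) m%:R <= _); last first.
  by rewrite sumr_const -mulrnA mulnC.
apply: ler_sum => h _.
apply: le_trans (_ : \sum_(c < m) 1 <= _); last by rewrite sumr_const card_ord.
apply: ler_sum => c _; apply: ler_avg_cst => // x.
by rewrite exprn_ile1 ?density_ge0 ?density_le1.
Qed.

Definition refines V (P' P : {set 'I_t} -> {ffun 'I_t -> V} -> nat) :=
  forall f x y, P' f x = P' f y -> P f x = P f y.

Lemma refines_key V d P' P h (x y : {ffun 'I_t -> V}) : refines P' P ->
  boundary_key d P' h x = boundary_key d P' h y ->
  boundary_key d P h x = boundary_key d P h y.
Proof.
by move=> PP /boundary_keyP e; apply/boundary_keyP => f fh fd; exact/PP/e.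
Qed.

Lemma energy_gap V d m Q P' P h c (b : R) : @refines V P' P -> (c < m)%N ->
  b <= avg (fun x => density d Q P' h c x ^+ 2)
       - avg (fun x => density d Q P h c x ^+ 2) ->
  energy d m Q P + b <= energy d m Q P'.
Proof.
move=> PP cm; rewrite -lerBrDl => bE; apply: le_trans bE _; rewrite lerBrDl.
set a := fun (P : {set 'I_t} -> {ffun 'I_t -> V} -> nat) h c =>
  avg (fun x => density d Q P h c x ^+ 2).
have aP h' c' : a P h' c' <= a P' h' c'.
  rewrite -subr_ge0 /a -avg_cexp_sqrB => [|x y]; last exact: refines_key.
  by apply: avg_ge0 => x; exact: sqr_ge0.
rewrite /energy -![avg _]/(a _ _ _).
rewrite (bigD1 h) //= [in X in _ <= X](bigD1 h) //=.
rewrite (bigD1 (Ordinal cm)) //= [in X in _ <= X](bigD1 (Ordinal cm)) //=.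
have h1 : \sum_(i < m | i != Ordinal cm) a P h i
    <= \sum_(i < m | i != Ordinal cm) a P' h i by apply: ler_sum.
have h2 : \sum_(i | i != h) \sum_(c0 < m) a P i c0
    <= \sum_(i | i != h) \sum_(c0 < m) a P' i c0.
  by apply: ler_sum => i _; apply: ler_sum.
rewrite -/(a P h c) -/(a P' h c); lra.
Qed.

(** A test that violates regularity is used to split the colours; it is then determined by the new
    boundary key, and [cexp_increment] applies. *)
Lemma refinement_step V d m (eta : R) Q P M : 0 < eta ->
  (forall f, local f (P f)) -> (forall f (x : {ffun 'I_t -> V}), P f x < M)%N ->
  regular d m eta Q P \/
  exists P', [/\ forall f, local f (P' f), forall f x, (P' f x < M.*2)%N,
    refines P' P & energy d m Q P + eta ^+ 2 <= energy d m Q P'].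
Proof.
move=> eta0 lP PM; have [|nreg] := boolp.pselect (regular d m eta Q P).
  by left.
right; apply: boolp.contrapT => noP; apply: nreg => h c U cm lU.
rewrite leNgt; apply/negP => big; apply: noP.
(* The parity stores the test and the half stores the old colour. *)
pose P' (f : {set 'I_t}) (x : {ffun 'I_t -> V}) : nat := (U f x + (P f x).*2)%N.
have PP : refines P' P.
  by move=> f x y /(congr1 half); rewrite !half_bit_double.
have UP f x y : P' f x = P' f y -> U f x = U f y.
  by move=> /(congr1 odd); rewrite !oddD !odd_double !addbF !oddb.
exists P'; split => //.
- move=> f x y xy; rewrite /P' (lU f x y xy) (lP f x y xy) //.
- move=> f x; rewrite /P'; case: (U f x); rewrite ?add0n ?ltn_double ?PM //.
  by rewrite add1n ltn_Sdouble PM.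
- apply: (energy_gap (h := h) (c := c)) => //.
  apply: le_trans (cexp_increment (w := boundary_test d U h) _ _ _).
  + rewrite -[X in _ <= X]real_normK ?num_real //.
    by rewrite ler_sqr ?nnegrE ?normr_ge0 // ltW.
  + by move=> x y; exact: refines_key.
  + move=> x y /boundary_keyP e; apply: eq_forallb => f.
    by case: andP => // -[fh /eqP fd]; rewrite (UP f x y) // e.
Qed.

(** An energy bounded by [C] cannot rise by [eps] as often as [n] times. The complexity follows the
    fixed function [G], so it depends only on [M] and the number of steps. *)
Lemma iterate_increment (A : Type) (en : A -> R) (C eps : R)
    (cplx : nat -> A -> Prop) (rel : A -> A -> Prop) (good : nat -> A -> Prop)
    (G : nat -> nat) n :
  (forall a, rel a a) -> (forall a b c, rel a b -> rel b c -> rel a c) ->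
  (forall a, en a <= C) ->
  (forall M a, cplx M a -> good M a \/
    exists b, [/\ cplx (G M) b, rel a b & en a + eps <= en b]) ->
  forall M a, cplx M a -> C < en a + n%:R * eps ->
  exists i b, [/\ (i <= n)%N, cplx (iter i G M) b, rel a b
                & good (iter i G M) b].
Proof.
move=> relxx relT enC step; elim: n => [|n IHn] M a Ma.
  by rewrite mul0r addr0 ltNge enC.
have [gd _|[b [Mb ab en_ab]]] := step _ _ Ma; first by exists 0%N, a.
rewrite -natr1 mulrDl mul1r => Ca.
have [|i [c [ii Mc bc gc]]] := IHn _ _ Mb; first by lra.
by exists i.+1, c; split; rewrite ?iterSr //; apply: relT bc.
Qed.

Lemma archi_mul (C eps : R) : 0 < eps -> exists n : nat, C < n%:R * eps.
Proof.
move=> eps0; exists (Num.truncn (C / eps)).+1.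
by rewrite -ltr_pdivrMr // Num.Theory.truncnS_gt.
Qed.

Lemma refinement d m (eta : R) : 0 < eta ->
  exists n, forall V Q P M, (forall f, local f (P f)) ->
  (forall f (x : {ffun 'I_t -> V}), P f x < M)%N ->
  exists P', [/\ forall f, local f (P' f), forall f x, (P' f x < 2 ^ n * M)%N,
    refines P' P & regular d m eta Q P'].
Proof.
move=> eta0; have eta20 : 0 < eta ^+ 2 by rewrite exprn_gt0.
have [n nP] := archi_mul (#|{set 'I_t}| * m)%:R eta20.
exists n => V Q P M lP PM.
pose cplx M (P : {set 'I_t} -> {ffun 'I_t -> V} -> nat) :=
  (forall f, local f (P f)) /\ (forall f x, (P f x < M)%N).
have [|||||i [P' [iln [lP' P'M] PP' rP']]] :=
  @iterate_increment _ (energy d m Q) _ (eta ^+ 2) cplx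
   (fun P P' => refines P' P) (fun _ P => regular d m eta Q P) double n
   _ _ (energy_le d m Q) _ M P.
- by move=> a f x y.
- by move=> a b c ab bc f x y /bc/ab.
- move=> {}M {}P [{}lP {}PM].
  have [?|[P' [? ? ? ?]]] := refinement_step d m Q eta0 lP PM; first by left.
  by right; exists P'.
- by [].
- by apply: lt_le_trans nP _; rewrite lerDr energy_ge0.
exists P'; split => // f x; apply: leq_trans (P'M f x) _.
have -> : iter i double M = (2 ^ i * M)%N.
  by elim: i {iln P'M} => [|i IHi]; rewrite ?mul1n //= IHi expnS -muln2; lia.
by rewrite leq_mul2r leq_pexp2l ?orbT.
Qed.

(** Strong regularity: [P'] is regular to a degree chosen after the number [M] of colours of [P],
    yet its densities stay close to those of [P] in mean square. Refinement is repeated until the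
    energy gain falls below [eps], which bounds the mean square by Pythagoras. *)
Lemma regularity d m (eps : R) (eta : nat -> R) :
  0 < eps -> (forall M, 0 < eta M) ->
  exists Mmax, forall V (Q : {set 'I_t} -> {ffun 'I_t -> V} -> nat),
  exists M P P', [/\ (M <= Mmax)%N,
    (forall f, local f (P f)) /\ (forall f x, (P f x < M)%N),
    forall f, local f (P' f), regular d m (eta M) Q P' &
    forall h c, (c < m)%N ->
      avg (fun x => (density d Q P' h c x - density d Q P h c x) ^+ 2) <= eps].
Proof.
move=> eps0 eta0.
have [G GP] := boolp.choice (fun M => refinement d m (eta0 M)).
have [n nP] := archi_mul (#|{set 'I_t}| * m)%:R eps0.
pose G' M := (2 ^ G M * M)%N.
(* The iteration starts from a single colour and may stop at any stage up to [n]. *)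
exists (\max_(i < n.+1) iter i G' 1%N) => V Q.
pose cplx M (P : {set 'I_t} -> {ffun 'I_t -> V} -> nat) :=
  (forall f, local f (P f)) /\ (forall f x, (P f x < M)%N).
pose good M P := exists P', [/\ forall f, local f (P' f),
  regular d m (eta M) Q P', refines P' P &
  energy d m Q P' < energy d m Q P + eps].
have [|||||i [P [iln cP _ [P' [lP' rP' PP' eP']]]]] :=
  @iterate_increment _ (energy d m Q) _ eps cplx
   (fun _ _ => True) good G' n
   _ _ (energy_le d m Q) _ 1%N (fun _ _ => 0%N).
- by [].
- by [].
- move=> M P [lP PM]; have [P' [lP' P'M PP' rP']] := GP M V Q P M lP PM.
  have [le|lt] := leP (energy d m Q P + eps) (energy d m Q P').
    by right; exists P'.
  by left; exists P'.
- by split.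
- by apply: lt_le_trans nP _; rewrite lerDr energy_ge0.
exists (iter i G' 1%N), P, P'; split => //.
  have iln1 : (i < n.+1)%N by [].
  exact: (@leq_bigmax _ (fun i : 'I_n.+1 => iter i G' 1%N) (Ordinal iln1)).
move=> h c cm; rewrite leNgt; apply/negP => big.
have := energy_gap (d := d) (Q := Q) (h := h) PP' cm (lexx _).
rewrite /density -avg_cexp_sqrB => [|x y]; last exact: refines_key.
move: big eP'; rewrite /density; lra.
Qed.

End Regularity.

(** * Shapes, cells and doubling *)

Section Faces.
Variable t : nat.
Implicit Types (N V : finType) (h f : {set 'I_t}).

(* Shape vertices are pairs (n, j), a copy n of the coordinate j, placed by
   y : N -> V^t at y n j; a face picks one copy of each coordinate of its
   domain. *)
Definition face N := {ffun 'I_t -> option N}.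

Definition dom N (phi : face N) : {set 'I_t} := [set j | isSome (phi j)].

Definition restr N h (phi : face N) : face N :=
  [ffun j => if j \in h then phi j else None].

Definition closed N (S : {set face N}) :=
  forall h phi, phi \in S -> restr h phi \in S.

(** Here [x] is a filler outside the domain of [phi]; functions local on that domain do not see
    it. *)
Definition pull N V (x : {ffun 'I_t -> V}) (phi : face N)
    (y : {ffun N -> {ffun 'I_t -> V}}) : {ffun 'I_t -> V} :=
  [ffun j => if phi j is Some n then y n j else x j].

Definition subst N V (phi : face N) (y : {ffun N -> {ffun 'I_t -> V}})
    (z : {ffun 'I_t -> V}) : {ffun N -> {ffun 'I_t -> V}} :=
  [ffun n => [ffun j => if phi j == Some n then z j else y n j]].

Definition cell N V (P : {set 'I_t} -> {ffun 'I_t -> V} -> nat)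
    (S : {set face N}) (x : {ffun 'I_t -> V}) y : bool :=
  [forall phi in S, P (dom phi) (pull x phi y) == P (dom phi) x].

Lemma dom_restr N h (phi : face N) : dom (restr h phi) = h :&: dom phi.
Proof. by apply/setP => j; rewrite !inE ffunE; case: ifP. Qed.

Lemma restr_dom N (phi : face N) : restr (dom phi) phi = phi.
Proof.
by apply/ffunP => j; rewrite ffunE inE; case: (phi j).
Qed.

Lemma pull_local N V A (u : {ffun 'I_t -> V} -> A) (phi : face N) x x' y :
  local (dom phi) u -> u (pull x phi y) = u (pull x' phi y).
Proof.
by apply => j; rewrite inE !ffunE; case: (phi j).
Qed.

(** Resampling: exchanging the vertices of [phi] in [y] with the matching coordinates of [z] is an
    involution on pairs, hence preserves averages. *)
Lemma avg_subst (R : archiRealFieldType) N V (phi : face N)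
    (K : {ffun N -> {ffun 'I_t -> V}} -> {ffun 'I_t -> V} -> R) x :
  (forall y, local (dom phi) (K y)) ->
  avg (fun y => avg (fun z => K (subst phi y z) z))
    = avg (fun y => K y (pull x phi y)).
Proof.
move=> lK.
transitivity (avg (fun y => avg (fun z => K y (pull z phi y)))); last first.
  apply: eq_avg => y.
  rewrite -[RHS](@avg_cst _ {ffun 'I_t -> V}); last by apply/card_gt0P; exists x.
  by apply: eq_avg => z; exact: pull_local.
rewrite !avg_pair.
pose g (p : {ffun N -> {ffun 'I_t -> V}} * {ffun 'I_t -> V}) :=
  (subst phi p.1 p.2, pull p.2 phi p.1).
have gK : involutive g.
  move=> [y z]; rewrite /g /=; congr (_, _).
    apply/ffunP => n; apply/ffunP => j; rewrite !ffunE.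
    by case: eqP => [->|//].
  apply/ffunP => j; rewrite !ffunE.
  by case E: (phi j) => [n|//]; rewrite !ffunE E eqxx.
rewrite (avg_bij _ (inv_bij gK)); apply: eq_avg => -[y z] /=.
by congr (K _ _); have := gK (y, z); rewrite /g /=; case.
Qed.

Lemma cellU N V (P : {set 'I_t} -> {ffun 'I_t -> V} -> nat)
    (S1 S2 : {set face N}) (x : {ffun 'I_t -> V}) y :
  cell P (S1 :|: S2) x y = cell P S1 x y && cell P S2 x y.
Proof.
apply/forall_inP/andP => [c|[/forall_inP c1 /forall_inP c2] phi].
  by split; apply/forall_inP => phi pS; apply: c; rewrite inE pS ?orbT.
by rewrite inE => /orP[/c1|/c2].
Qed.

Lemma cell1 N V (P : {set 'I_t} -> {ffun 'I_t -> V} -> nat)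
    (phi : face N) (x : {ffun 'I_t -> V}) y :
  cell P [set phi] x y = (P (dom phi) (pull x phi y) == P (dom phi) x).
Proof.
apply/forall_inP/idP => [->//|e psi]; first by rewrite set11.
by rewrite inE => /eqP ->.
Qed.

(* A face other than phi shares with phi at most a proper subset of its
   vertices, so once the vertices outside phi are fixed, its colour only
   depends on a facet of phi. *)
Lemma cell_boundary_test N V d
    (P : {set 'I_t} -> {ffun 'I_t -> V} -> nat)
    (phi : face N) (S : {set face N}) (x : {ffun 'I_t -> V}) y :
  (forall f, local f (P f)) ->
  #|dom phi| = d.+1 -> phi \notin S ->
  (forall psi, psi \in S -> #|dom psi| <= d.+1)%N ->
  exists U : {set 'I_t} -> {ffun 'I_t -> V} -> bool,
    (forall f, local f (U f)) /\
    forall z, cell P S x (subst phi y z) = boundary_test d U (dom phi) z.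
Proof.
move=> lP phid phiS Sd.
(* [sel psi] drops from [phi] a vertex that [psi] does not use, so [psi] sees at most this facet of
   [phi]. Below, [U f] gathers the conditions of all faces assigned to the facet [f]. *)
pose agree psi := [set j | isSome (phi j) && (phi j == psi j)].
pose sel psi := if [pick j in dom phi :\: agree psi] is Some j
                then dom phi :\ j else dom phi.
have selP psi : psi \in S ->
    exists2 j, sel psi = dom phi :\ j & j \in dom phi :\: agree psi.
  move=> pS; rewrite /sel; case: pickP => [j jP|nj]; first by exists j.
  (* A face through every vertex of [phi] has no others, by the bound on dimensions, and would be
     [phi] itself. *)
  have pp j : j \in dom phi -> phi j = psi j.
    move=> jd; have := nj j; rewrite !inE in jd *.
    by rewrite jd andbT => /negbFE/eqP.
  have sd : dom phi \subset dom psi.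
    by apply/subsetP => j jd; have := pp _ jd; move: jd; rewrite !inE => + <-.
  have ed : dom phi = dom psi by apply/eqP; rewrite eqEcard sd phid Sd.
  suff e : phi = psi by rewrite e pS in phiS.
  apply/ffunP => j; have [/pp//|] := boolP (j \in dom phi).
  move=> n1; have := n1; rewrite ed; move: n1; rewrite !inE.
  by case: (phi j); case: (psi j).
pose U f z := [forall psi in S, (sel psi == f) ==>
   (P (dom psi) (pull x psi (subst phi y z)) == P (dom psi) x)].
exists U; split.
  move=> f z z' zz; apply: eq_forallb_in => psi pS; case: eqP => //= sf.
  congr (_ == _); apply: lP => j; rewrite inE !ffunE.
  case E: (psi j) => [n|//] _; rewrite !ffunE; case: eqP => // En.
  apply: zz; rewrite -sf; have [j0 -> j0P] := selP _ pS.
  rewrite !inE En /= andbT; apply: contraTneq j0P => <-.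
  by rewrite !inE En E eqxx.
move=> z; apply/forall_inP/forallP => [c f|c psi pS].
  apply/implyP => _; apply/forall_inP => psi pS; apply/implyP => _; exact: c.
have [j0 sj0 j0P] := selP _ pS.
have := c (sel psi); rewrite sj0 subD1set /=.
have -> : #|dom phi :\ j0| == d.
  by have := cardsD1 j0 (dom phi); rewrite phid; case/setDP: j0P => -> _ [->].
by move=> /forall_inP /(_ psi pS); rewrite sj0 eqxx.
Qed.

Definition dblL N (psi : face N) : face (N + N)%type :=
  [ffun j => if psi j is Some n then Some (inl n) else None].

(** The second copy of the shape uses the names [inr], except that vertices of [phi] keep their
    names from the first copy: the two copies are glued along [phi]. *)
Definition dblR N (phi psi : face N) : face (N + N)%type :=
  [ffun j => if psi j is Some n
             then Some (if phi j == Some n then inl n else inr n) else None].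

Definition dbl N (phi : face N) (S : {set face N}) : {set face (N + N)%type} :=
  (@dblL N @: S) :|: (dblR phi @: S).

Lemma dom_dblL N (psi : face N) : dom (dblL psi) = dom psi.
Proof. by apply/setP => j; rewrite !inE ffunE; case: (psi j). Qed.

Lemma dom_dblR N (phi psi : face N) : dom (dblR phi psi) = dom psi.
Proof. by apply/setP => j; rewrite !inE ffunE; case: (psi j). Qed.

Lemma closed_dbl N (phi : face N) (S : {set face N}) : closed S -> closed (dbl phi S).
Proof.
move=> cS h psi; rewrite !inE => /orP[] /imsetP[chi cS' ->].
  apply/orP; left; apply/imsetP; exists (restr h chi); first exact: cS.
  by apply/ffunP => j; rewrite !ffunE; case: ifP.
apply/orP; right; apply/imsetP; exists (restr h chi); first exact: cS.
by apply/ffunP => j; rewrite !ffunE; case: ifP.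
Qed.

Lemma dim_dbl N (phi : face N) (S : {set face N}) d :
  (forall psi, psi \in S -> #|dom psi| <= d)%N ->
  forall psi, psi \in dbl phi S -> (#|dom psi| <= d)%N.
Proof.
move=> Sd psi; rewrite !inE => /orP[] /imsetP[chi cS' ->].
  by rewrite dom_dblL Sd.
by rewrite dom_dblR Sd.
Qed.

Lemma dblL_inj N : injective (@dblL N).
Proof.
move=> a b /ffunP e; apply/ffunP => j; have := e j; rewrite !ffunE.
by case: (a j); case: (b j) => // u v [->].
Qed.

Lemma dblR_inj N (phi : face N) : injective (dblR phi).
Proof.
move=> a b /ffunP e; apply/ffunP => j; have := e j; rewrite !ffunE.
case: (a j) => [u|]; case: (b j) => [v|] //.
by case: (phi j == Some u); case: (phi j == Some v) => // -[->].
Qed.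

(** Since [phi] is not in [S], the two glued copies share exactly the proper subfaces of [phi];
    multiplying by these once more restores the square. *)
Lemma prod_dbl (R : comNzRingType) N (phi : face N) (S : {set face N})
    (p : {set 'I_t} -> R) :
  phi \notin S -> (forall f : {set 'I_t}, f \proper dom phi -> restr f phi \in S) ->
  (\prod_(psi in dbl phi S) p (dom psi))
    * \prod_(f : {set 'I_t} | f \proper dom phi) p f
  = (\prod_(psi in S) p (dom psi)) ^+ 2.
Proof.
move=> phiS clS.
set A := @dblL N @: S; set B := dblR phi @: S.
have eL : \prod_(psi in S) p (dom psi) = \prod_(psi in A) p (dom psi).
  rewrite big_imset /=; last by move=> a b _ _; exact: dblL_inj.
  by apply: eq_bigr => psi _; rewrite dom_dblL.
have eR : \prod_(psi in S) p (dom psi) = \prod_(psi in B) p (dom psi).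
  rewrite big_imset /=; last by move=> a b _ _; exact: dblR_inj.
  by apply: eq_bigr => psi _; rewrite dom_dblR.
have eI : \prod_(psi in B :&: A) p (dom psi) =
    \prod_(f : {set 'I_t} | f \proper dom phi) p f.
  have -> : B :&: A = (fun f => dblL (restr f phi))
                        @: [set f : {set 'I_t} | f \proper dom phi].
    apply/setP => chi; apply/setIP/imsetP.
      move=> [/imsetP[psi pS ->] /imsetP[psi' pS' e]].
      (* A common face uses only vertices of [phi]: every other vertex of the second copy is named
         by [inr]. *)
      have pj j n : psi j = Some n -> phi j = Some n /\ psi' j = Some n.
        move: e => /ffunP /(_ j); rewrite !ffunE => + E; rewrite E.
        by case: eqP => [-> |_]; case: (psi' j) => // a [->].
      have e1 : psi = restr (dom psi) phi.
        apply/ffunP => j; rewrite ffunE inE; case E: (psi j) => [n|] //=.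
        by have [->] := pj _ _ E.
      exists (dom psi).
        rewrite inE properEneq; apply/andP; split.
          by apply: contraNneq phiS => e2; rewrite e2 restr_dom in e1; rewrite -e1.
        apply/subsetP => j; rewrite !inE; case E: (psi j) => [n|] // _.
        by have [->] := pj _ _ E.
      rewrite -e1; apply/ffunP => j; rewrite !ffunE.
      by case E: (psi j) => [n|] //; have [-> _] := pj _ _ E; rewrite eqxx.
    move=> [f]; rewrite inE => fp ->; split; apply/imsetP; exists (restr f phi).
    - exact: clS.
    - apply/ffunP => j; rewrite !ffunE; case: ifP => // _.
      by case: (phi j) => // n; rewrite eqxx.
    - exact: clS.
    - by [].
  rewrite big_imset /=.
    apply: eq_big => [f|f]; rewrite inE // => /proper_sub /setIidPl fp.
    by rewrite dom_dblL dom_restr fp.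
  move=> f f'; rewrite !inE => /proper_sub /setIidPl fp /proper_sub /setIidPl fp'.
  by move=> /dblL_inj /(congr1 (@dom _)); rewrite !dom_restr fp fp'.
rewrite expr2 {1}eL eR -/A -/B.
rewrite (big_setID A) /= [X in _ = _ * X](big_setID A) /= -eI.
have -> : dbl phi S :&: A = A by apply/setIidPr; exact: subsetUl.
have -> : dbl phi S :\: A = B :\: A by rewrite /dbl setDUl setDv set0U.
ring.
Qed.

Lemma cell_dbl N V (P : {set 'I_t} -> {ffun 'I_t -> V} -> nat)
    (phi : face N) (S : {set face N}) (x : {ffun 'I_t -> V})
    (y : {ffun (N + N)%type -> {ffun 'I_t -> V}}) :
  cell P (dbl phi S) x y =
  cell P S x [ffun n => y (inl n)] &&
  cell P S x (subst phi [ffun n => y (inr n)] (pull x phi [ffun n => y (inl n)])).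
Proof.
rewrite cellU; congr (_ && _).
  apply/forall_inP/forall_inP => c psi.
    move=> pS; have := c _ (imset_f _ pS); rewrite dom_dblL.
    congr (P _ _ == _); apply/ffunP => j; rewrite !ffunE.
    by case: (psi j) => // n; rewrite ?ffunE.
  move=> /imsetP[chi cS ->]; have := c _ cS; rewrite dom_dblL.
  congr (P _ _ == _); apply/ffunP => j; rewrite !ffunE.
  by case: (chi j) => // n; rewrite ?ffunE.
have e psi : pull x (dblR phi psi) y = pull x psi
    (subst phi [ffun n => y (inr n)] (pull x phi [ffun n => y (inl n)])).
  apply/ffunP => j; rewrite !ffunE; case: (psi j) => // n; rewrite !ffunE.
  by case: eqP => [->|_]; rewrite ?ffunE.
apply/forall_inP/forall_inP => c psi.
  by move=> pS; have := c _ (imset_f _ pS); rewrite dom_dblR e.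
by move=> /imsetP[chi cS ->]; have := c _ cS; rewrite dom_dblR e.
Qed.

Lemma avg_sum_type (R : archiRealFieldType) N1 N2 (X : finType)
    (F : {ffun N1 -> X} -> {ffun N2 -> X} -> R) :
  avg (fun y : {ffun (N1 + N2)%type -> X} =>
         F [ffun n => y (inl n)] [ffun n => y (inr n)])
  = avg (fun y1 => avg (fun y2 => F y1 y2)).
Proof.
rewrite avg_pair.
pose g (y : {ffun (N1 + N2)%type -> X}) : {ffun N1 -> X} * {ffun N2 -> X} :=
  ([ffun n => y (inl n)], [ffun n => y (inr n)]).
rewrite (@avg_bij _ _ _ g) //.
exists (fun p : {ffun N1 -> X} * {ffun N2 -> X} =>
   [ffun s : N1 + N2 => match s return X with inl n => p.1 n | inr n => p.2 n end]).
  by move=> y; apply/ffunP => -[n|n]; rewrite !ffunE.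
by move=> [a b]; congr (_, _); apply/ffunP => n; rewrite !ffunE.
Qed.

Definition lower V (P : {set 'I_t} -> {ffun 'I_t -> V} -> nat) h
    (x z : {ffun 'I_t -> V}) : bool :=
  [forall f : {set 'I_t}, (f \proper h) ==> (P f z == P f x)].

Lemma cell_lower N V (P : {set 'I_t} -> {ffun 'I_t -> V} -> nat)
    (phi : face N) (S : {set face N}) (x : {ffun 'I_t -> V}) y z :
  (forall f, local f (P f)) ->
  (forall f : {set 'I_t}, f \proper dom phi -> restr f phi \in S) ->
  cell P S x (subst phi y z) -> lower P (dom phi) x z.
Proof.
move=> lP clS /forall_inP c; apply/forallP => f; apply/implyP => fp.
have := c _ (clS _ fp); rewrite dom_restr (setIidPl (proper_sub fp)).
congr (_ == _); apply: lP => j jf; rewrite !ffunE jf.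
have := subsetP (proper_sub fp) _ jf; rewrite inE.
by case E: (phi j) => [n|] // _; rewrite !ffunE E eqxx.
Qed.

(** Once the vertices of [phi] are resampled as [z], the cell forces [lower] on [z]; this indicator
    is attached to [b] and confines its square norm to the lower cell. Cauchy-Schwarz in [z] leaves
    the second moment of the number of completions of [z]. It counts pairs of configurations sharing
    [phi], that is, the doubled shape. *)
Lemma avg_cell_CauchySchwarz (R : archiRealFieldType) N V
    (P : {set 'I_t} -> {ffun 'I_t -> V} -> nat) (phi : face N) (S : {set face N})
    (x : {ffun 'I_t -> V}) (b : {ffun 'I_t -> V} -> R) :
  (forall f, local f (P f)) ->
  (forall f : {set 'I_t}, f \proper dom phi -> restr f phi \in S) ->
  local (dom phi) b ->
  avg (fun y => (cell P S x y)%:R * `|b (pull x phi y)|) ^+ 2 <=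
  avg (fun z => (lower P (dom phi) x z)%:R * b z ^+ 2)
    * avg (fun y => (cell P (dbl phi S) x y)%:R).
Proof.
move=> lP clS lb.
rewrite -(@avg_subst R _ _ phi (fun y z => (cell P S x y)%:R * `|b z|)); last first.
  by move=> y z z' zz; rewrite (lb z z').
rewrite avg_exchange.
have -> : avg (fun z => avg (fun y => (cell P S x (subst phi y z))%:R * `|b z|))
  = avg (fun z => ((lower P (dom phi) x z)%:R * `|b z|)
                  * avg (fun y => (cell P S x (subst phi y z))%:R)).
  apply: eq_avg => z; rewrite -avgZ; apply: eq_avg => y.
  case E: (cell _ _ _ _); last by rewrite mul0r mulr0.
  by rewrite (cell_lower lP clS E) !mul1r mulr1.
apply: le_trans (avg_CauchySchwarz _ _) _.
rewrite le_eqVlt; apply/orP; left; apply/eqP; congr (_ * _).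
  apply: eq_avg => z; rewrite exprMn real_normK ?num_real //.
  by case: (lower _ _ _ _); rewrite ?expr1n ?expr0n.
under [RHS]eq_avg do rewrite cell_dbl.
rewrite (avg_sum_type (fun y w =>
  (cell P S x y && cell P S x (subst phi w (pull x phi y)))%:R)).
transitivity (avg (fun y => avg (fun z => (cell P S x (subst phi y z))%:R *
   avg (fun w => (cell P S x (subst phi w z))%:R : R)))).
  rewrite avg_exchange; apply: eq_avg => z.
  under [RHS]eq_avg do rewrite mulrC.
  by rewrite avgZ expr2.
rewrite (@avg_subst R _ _ phi (fun y z => (cell P S x y)%:R *
   avg (fun w => (cell P S x (subst phi w z))%:R : R)) x).
  by apply: eq_avg => y; rewrite -avgZ; apply: eq_avg => w; rewrite natr_and.
move=> y z z' zz; congr (_ * _); apply: eq_avg => w; congr (_%:R).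
congr (nat_of_bool (cell _ _ _ _)); apply/ffunP => n; apply/ffunP => j.
rewrite !ffunE; case: eqP => // E; apply: zz.
by rewrite inE E.
Qed.

End Faces.

(** * Counting and removal *)

Section ConditionalBounds.
Variables (R : archiRealFieldType) (T : finType).

Lemma avg_fiber_le (K : eqType) (key : T -> K) (F : T -> R) x (a : R) :
  cexp key F x <= a ->
  avg (fun y => (key y == key x)%:R * F y)
    <= a * avg (fun y => (key y == key x)%:R).
Proof.
rewrite /cexp ler_pdivrMr ?fiber_gt0 // => le.
rewrite /avg mulrA ler_wpM2r ?invr_ge0 ?ler0n //.
apply: le_trans (_ : \sum_(y | key y == key x) F y <= _).
  by rewrite [leRHS]big_mkcond /= ler_sum // => y _; case: eqP; rewrite ?mul1r ?mul0r.
apply: le_trans le _; rewrite -sum1_card natr_sum big_mkcond mulrC /=.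
rewrite le_eqVlt; apply/orP; left; apply/eqP; rewrite mulrC; congr (_ * _).
by apply: eq_bigr => y _; rewrite inE; case: eqP.
Qed.

Lemma avg_markov (F : T -> R) (a : R) : 0 < a -> (forall x, 0 <= F x) ->
  avg (fun x => (a < F x)%R%:R) <= avg F / a.
Proof.
move=> a0 F0; rewrite ler_pdivlMr // mulrC -avgZ; apply: ler_avg => x.
by case: ltP => [/ltW|_]; rewrite ?mulr1 ?mulr0.
Qed.

End ConditionalBounds.

(** * Adding faces of the top dimension to a cell *)

Section CellExtension.
Variables (R : archiRealFieldType) (t : nat) (N V : finType) (d : nat).
Variables (P : {set 'I_t} -> {ffun 'I_t -> V} -> nat) (x : {ffun 'I_t -> V}).
Hypothesis lP : forall f, local f (P f).

Lemma subst_pull (phi : face t N) (y : {ffun N -> {ffun 'I_t -> V}}) :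
  subst phi y (pull x phi y) = y.
Proof.
apply/ffunP => n; apply/ffunP => j; rewrite !ffunE.
by case: eqP => // ->.
Qed.

(* On a cell of S0 the indicator of the colour class of x is q + b + g: g
   averages out against the other faces and b is small on the cell. *)
Lemma avg_cell_extend (S0 S1 : {set face t N}) (q : {set 'I_t} -> R)
    (b g : {set 'I_t} -> {ffun 'I_t -> V} -> R) (eta theta : R) :
  (forall phi, phi \in S0 -> #|dom phi| <= d)%N ->
  (forall phi, phi \in S1 -> #|dom phi| = d.+1) ->
  (forall phi (f : {set 'I_t}), phi \in S1 -> f \proper dom phi ->
     restr f phi \in S0) ->
  (forall h : {set 'I_t}, #|h| = d.+1 -> 0 <= q h <= 1) ->
  (forall h : {set 'I_t}, #|h| = d.+1 -> local h (g h)) ->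
  (forall (h : {set 'I_t}) z, #|h| = d.+1 -> lower P h x z ->
     (P h z == P h x)%:R = q h + b h z + g h z) ->
  0 <= eta ->
  (forall (h : {set 'I_t}) U, #|h| = d.+1 -> (forall f, local f (U f)) ->
     `|avg (fun z => g h z * (boundary_test d U h z)%:R)| <= eta) ->
  (forall phi, phi \in S1 ->
     avg (fun y => (cell P S0 x y)%:R * `|b (dom phi) (pull x phi y)|)
       <= theta) ->
  `|avg (fun y => (cell P (S0 :|: S1) x y)%:R)
    - (\prod_(phi in S1) q (dom phi)) * avg (fun y => (cell P S0 x y)%:R)|
  <= #|S1|%:R * (eta + theta).
Proof.
move=> S0d + + q01 lg dec eta0 reg.
have [n] := ubnP #|S1|; elim: n S1 => // n IHn S1 + S1d S1c bth.
have [->|[phi phiS]] := set_0Vmem S1.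
  by move=> _; rewrite setU0 big_set0 mul1r subrr normr0 cards0 mul0r.
(* The faces of [S1] are removed one at a time, each at the cost of [eta + theta]. *)
set S2 := S1 :\ phi; rewrite (cardsD1 phi) phiS add1n ltnS => S2n.
have sub2 psi : psi \in S2 -> psi \in S1 by rewrite inE => /andP[].
have {}IHn := IHn S2 S2n (fun psi pS => S1d psi (sub2 _ pS))
   (fun psi f pS => S1c psi f (sub2 _ pS)) (fun psi pS => bth psi (sub2 _ pS)).
have phid := S1d _ phiS; set h := dom phi in phid *.
have phiS02 : phi \notin S0 :|: S2.
  rewrite !inE eqxx orbF; apply: contraTN isT => /S0d.
  by rewrite -/h phid ltnn.
have S02d psi : psi \in S0 :|: S2 -> (#|dom psi| <= d.+1)%N.
  by rewrite inE => /orP[/S0d/leqW//|/sub2/S1d ->].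
have eS : S0 :|: S1 = (S0 :|: S2) :|: [set phi].
  by rewrite -setUA [S2 :|: _]setUC setD1K.
have -> : avg (fun y => (cell P (S0 :|: S1) x y)%:R) =
   q h * avg (fun y => (cell P (S0 :|: S2) x y)%:R) +
   avg (fun y => (cell P (S0 :|: S2) x y)%:R * b h (pull x phi y)) +
   avg (fun y => (cell P (S0 :|: S2) x y)%:R * g h (pull x phi y)) :> R.
  rewrite -avgZ -!avgD; apply: eq_avg => y; rewrite eS cellU natr_and cell1 -/h.
  case E: (cell P (S0 :|: S2) x y); last by rewrite !mul0r mulr0 !addr0.
  have low : lower P h x (pull x phi y).
    move: E; rewrite cellU => /andP[+ _]; rewrite -{1}(subst_pull phi y).
    by apply: cell_lower => // f fp; exact: S1c.
  by rewrite dec //; ring.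
(* With the vertices outside [phi] fixed, the cell of the other faces is a boundary test, so the
   quasirandomness of [g] applies. *)
have gle : `|avg (fun y => (cell P (S0 :|: S2) x y)%:R * g h (pull x phi y))|
    <= eta.
  rewrite -(@avg_subst _ _ _ _ phi
    (fun y z => (cell P (S0 :|: S2) x y)%:R * g h z)).
    apply: le_trans (ler_norm_avg _) _; apply: ler_avg_cst => // y.
    have [U [lU cU]] := cell_boundary_test (S := S0 :|: S2) x y lP phid phiS02 S02d.
    under eq_avg do rewrite cU mulrC.
    exact: reg.
  by move=> y z z' zz; rewrite (lg h phid z z').
have ble : `|avg (fun y => (cell P (S0 :|: S2) x y)%:R * b h (pull x phi y))|
    <= theta.
  apply: le_trans (ler_norm_avg _) _; apply: le_trans (bth _ phiS).
  apply: ler_avg => y; rewrite normrM cellU natr_and normrM.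
  rewrite !normr_nat -mulrA; case: (cell P S0 x y); rewrite ?mul0r // !mul1r.
  by rewrite ler_piMl // lern1 leq_b1.
rewrite (big_setD1 phi) //= -/S2 -/h -natr1.
have /andP[q0 q1] := q01 h phid.
set A := avg _ in IHn *; set B := avg _ in ble *; set C := avg _ in gle *.
set D := avg _ in IHn *; set Pi := \prod_(_ in S2) _ in IHn *.
have -> : q h * A + B + C - q h * Pi * D = q h * (A - Pi * D) + (B + C) by ring.
apply: le_trans (ler_normD _ _) _; rewrite mulrDl mul1r.
apply: lerD.
  by rewrite normrM (ger0_norm q0); apply: le_trans IHn; rewrite ler_piMl.
by rewrite (addrC eta); apply: le_trans (ler_normD _ _) _; exact: lerD.
Qed.

(** Writes the measure of the lower cell as the count of a shape with one copy of each coordinate,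
    so that the induction hypothesis estimates it as well. *)
Lemma avg_cell_unit (h : {set 'I_t}) :
  avg (fun y => (cell P [set psi : face t unit | dom psi \proper h] x y)%:R)
  = avg (fun z => (lower P h x z)%:R) :> R.
Proof.
pose phi0 : face t unit := [ffun _ => Some tt].
have V0 : (0 < #|{ffun unit -> {ffun 'I_t -> V}}|)%N.
  by apply/card_gt0P; exists [ffun _ => x].
rewrite -[RHS](avg_cst _ V0).
rewrite (@avg_subst _ R _ _ phi0 (fun y z => (lower P h x z)%:R) x).
  apply: eq_avg => y; congr (nat_of_bool _)%:R.
  apply/forall_inP/forallP => [c f|c psi].
    apply/implyP => fh.
    have := c (restr f phi0); rewrite inE dom_restr.
    have -> : dom phi0 = setT by apply/setP => j; rewrite !inE ffunE.
    rewrite setIT => /(_ fh); congr (_ == _); apply: lP => j jf.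
    by rewrite !ffunE jf ?ffunE.
  rewrite inE => ph; have := c (dom psi); rewrite ph /=; congr (_ == _).
  apply: lP => j; rewrite inE !ffunE; case: (psi j) => [[]|] // _; rewrite ?ffunE.
move=> y z z' zz; congr (nat_of_bool (lower _ _ _ _))%:R; apply/ffunP => j.
by apply: zz; rewrite inE ffunE.
Qed.

Lemma prod_unit (p : {set 'I_t} -> R) (h : {set 'I_t}) :
  \prod_(psi in [set psi : face t unit | dom psi \proper h]) p (dom psi)
  = \prod_(f : {set 'I_t} | f \proper h) p f.
Proof.
pose F (f : {set 'I_t}) : face t unit := [ffun j => if j \in f then Some tt else None].
have domF f : dom (F f) = f by apply/setP => j; rewrite inE ffunE; case: ifP.
have FK psi : F (dom psi) = psi.
  by apply/ffunP => j; rewrite ffunE inE; case: (psi j) => // -[].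
rewrite (reindex_onto F (@dom t unit)) => [|psi _]; last exact: FK.
by apply: eq_big => [f|f _]; rewrite ?inE domF ?eqxx ?andbT.
Qed.

End CellExtension.

(** * Counting from dimension [d] to [d.+1] *)

Section Counting.
Variables (R : archiRealFieldType) (t : nat).

Lemma ler_prod_exp (I : finType) (A : {set I}) (F : I -> R) a n :
  0 <= a <= 1 -> (#|A| <= n)%N -> (forall i, i \in A -> a <= F i) ->
  a ^+ n <= \prod_(i in A) F i.
Proof.
move=> /andP[a0 a1] An aF; apply: le_trans (_ : a ^+ #|A| <= _).
  by rewrite ler_wiXn2l.
by rewrite -prodr_const; apply: ler_prod => i iA; rewrite a0 aF.
Qed.

Lemma norm_le2 (u v s : R) : 0 <= s <= 1 -> 0 <= v -> `|u - v| <= s * v ->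
  u <= 2 * v.
Proof.
move=> /andP[s0 s1] v0; rewrite ler_norml => /andP[_].
have : s * v <= v by rewrite ler_piMl.
lra.
Qed.

(** Half of [tau] pays for the count in dimension [d], a quarter each for [b] and [g]. The error
    from [b] is relative to the product over the lower faces, so [kappa] is compared with [eta]
    alone; only [reg] has to beat [delta ^+ K]. The bound [(L + L).+1] admits the doubled shape, and
    the one-copy shape even when [L] is 0. *)
Lemma cell_count_step (V : finType) (d L K : nat)
    (P : {set 'I_t} -> {ffun 'I_t -> V} -> nat) (x : {ffun 'I_t -> V})
    (p : {set 'I_t} -> R) (b g : {set 'I_t} -> {ffun 'I_t -> V} -> R)
    (delta eta kappa reg tau tau' : R) :
  (forall f, local f (P f)) ->
  0 < delta <= 1 -> 0 < eta <= 1 -> 0 <= kappa -> 0 <= reg ->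
  0 <= tau' <= 1 -> tau' <= tau / 2 ->
  (forall N : finType, #|N| <= L -> #|{: face t N}| <= K)%N ->
  K%:R * kappa <= tau / 4 * eta ^+ K ->
  K%:R * reg <= tau / 4 * (eta ^+ K * delta ^+ K) ->
  (forall h : {set 'I_t}, (#|h| <= d)%N -> delta <= p h) ->
  (forall h : {set 'I_t}, #|h| = d.+1 -> eta <= p h <= 1) ->
  (forall h : {set 'I_t}, #|h| = d.+1 -> local h (b h)) ->
  (forall h : {set 'I_t}, #|h| = d.+1 -> local h (g h)) ->
  (forall (h : {set 'I_t}) z, #|h| = d.+1 -> lower P h x z ->
     (P h z == P h x)%:R = p h + b h z + g h z) ->
  (forall (h : {set 'I_t}) U, #|h| = d.+1 -> (forall f, local f (U f)) ->
     `|avg (fun z => g h z * (boundary_test d U h z)%:R)| <= reg) ->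
  (forall h : {set 'I_t}, #|h| = d.+1 ->
     avg (fun z => (lower P h x z)%:R * b h z ^+ 2)
       <= kappa ^+ 2 / 4 * avg (fun z => (lower P h x z)%:R)) ->
  (forall (N : finType) (S : {set face t N}), (#|N| <= (L + L).+1)%N ->
     closed S -> (forall phi, phi \in S -> (#|dom phi| <= d)%N) ->
     `|avg (fun y => (cell P S x y)%:R) - \prod_(phi in S) p (dom phi)|
       <= tau' * \prod_(phi in S) p (dom phi)) ->
  forall (N : finType) (S : {set face t N}), (#|N| <= L)%N ->
     closed S -> (forall phi, phi \in S -> (#|dom phi| <= d.+1)%N) ->
     `|avg (fun y => (cell P S x y)%:R) - \prod_(phi in S) p (dom phi)|
       <= tau * \prod_(phi in S) p (dom phi).
Proof.
move=> lP d01 e01 k0 r0 /andP[t0 t1] tt KP Kk Kr pd pe lb lg dec rg bb IH.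
move=> N S NL clS Sd.
have /andP[d0 d1] := d01; have /andP[e0 e1] := e01.
set S0 := [set phi in S | #|dom phi| <= d]%N; set S1 := S :\: S0.
have S1P phi : phi \in S1 -> phi \in S /\ #|dom phi| = d.+1.
  rewrite !inE => /andP[+ pS]; rewrite pS /= -ltnNge => dl; split => //.
  by apply/eqP; rewrite eqn_leq dl Sd.
have S01 : S = S0 :|: S1.
  by apply/setP => phi; rewrite !inE; case: (phi \in S); case: leqP.
have S0d phi : phi \in S0 -> (#|dom phi| <= d)%N by rewrite inE => /andP[].
have clS0 : closed S0.
  move=> h phi; rewrite !inE => /andP[/clS -> /=]; rewrite dom_restr.
  by apply: leq_trans; rewrite subset_leq_card // subsetIr.
have restrS0 phi (f : {set 'I_t}) :
    phi \in S1 -> f \proper dom phi -> restr f phi \in S0.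
  move=> /S1P[pS pD] fp; rewrite inE clS // dom_restr.
  by rewrite (setIidPl (proper_sub fp)) -ltnS -pD proper_card.
have ppos (M : finType) (A : {set face t M}) :
    (forall phi, phi \in A -> (#|dom phi| <= d)%N) ->
    0 <= \prod_(phi in A) p (dom phi).
  move=> Ad; apply: prodr_ge0 => phi pA.
  by apply: le_trans (pd _ (Ad _ pA)); exact: ltW.
set Pi0 := \prod_(phi in S0) p (dom phi).
set Pi1 := \prod_(phi in S1) p (dom phi).
have Pi00 : 0 <= Pi0 by exact: ppos.
have Pi0K : delta ^+ K <= Pi0.
  apply: ler_prod_exp; first by rewrite (ltW d0).
    by apply: leq_trans (KP _ NL); exact: max_card.
  by move=> phi /S0d/pd.
have Pi1K : eta ^+ K <= Pi1.
  apply: ler_prod_exp; first by rewrite (ltW e0).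
    by apply: leq_trans (KP _ NL); exact: max_card.
  by move=> phi /S1P[_ /pe/andP[]].
have bth phi : phi \in S1 ->
    avg (fun y => (cell P S0 x y)%:R * `|b (dom phi) (pull x phi y)|)
       <= kappa * Pi0.
  move=> pS1; have [pS pD] := S1P _ pS1.
  rewrite -ler_sqr ?nnegrE; last by rewrite mulr_ge0.
    2: by apply: avg_ge0 => y; rewrite mulr_ge0 ?ler0n.
  have clphi (f : {set 'I_t}) : f \proper dom phi -> restr f phi \in S0.
    exact: restrS0.
  apply: le_trans (avg_cell_CauchySchwarz x lP clphi (lb _ pD)) _.
  have phiS0 : phi \notin S0 by apply: contraTN isT => /S0d; rewrite pD ltnn.
  have dblE := prod_dbl p phiS0 clphi.
  have dd := dim_dbl (phi := phi) S0d; have cd := closed_dbl (phi := phi) clS0.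
  have := IH _ _ _ cd dd; rewrite card_sum => /(_ (leqW (leq_add NL NL))).
  set Pid := \prod_(psi in dbl phi S0) p (dom psi) in dblE *.
  set cd' := avg _ => cdle.
  pose Su := [set psi : face t unit | dom psi \proper dom phi].
  have Sud psi : psi \in Su -> (#|dom psi| <= d)%N.
    by rewrite inE => /proper_card; rewrite pD.
  have clSu : closed Su.
    move=> h psi; rewrite !inE dom_restr; apply: sub_proper_trans.
    exact: subsetIr.
  have := IH _ _ _ clSu Sud; rewrite card_unit => /(_ isT).
  rewrite avg_cell_unit // prod_unit.
  have Pil0 : 0 <= \prod_(f : {set 'I_t} | f \proper dom phi) p f.
    by rewrite -prod_unit; exact: ppos.
  have Pid0 : 0 <= Pid by exact: ppos.
  set Pil := \prod_(f : {set 'I_t} | _) _ in dblE Pil0 *.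
  have := bb _ pD; set lw := avg _; set lo := avg _.
  rewrite -/Pi0 in dblE.
  move=> lwle lole.
  have lo2 : lo <= 2 * Pil.
    by apply: norm_le2 lole; rewrite ?t0 ?Pil0.
  have cd2 : cd' <= 2 * Pid.
    by apply: norm_le2 cdle; rewrite ?t0 ?Pid0.
  have cd0 : 0 <= cd' by apply: avg_ge0 => y; rewrite ler0n.
  have k2 : 0 <= kappa ^+ 2 / 4 by rewrite divr_ge0 ?sqr_ge0.
  (* The 4 in the hypothesis on [b] cancels the two factors 2, and [Pid * Pil] is [Pi0 ^+ 2] by the
     doubling identity. *)
  apply: le_trans (_ : (kappa ^+ 2 / 4 * (2 * Pil)) * (2 * Pid) <= _).
    apply: ler_pM => //; last by apply: le_trans lwle _; rewrite ler_wpM2l.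
    by apply: avg_ge0 => z; rewrite mulr_ge0 ?ler0n ?sqr_ge0.
  by rewrite exprMn -dblE le_eqVlt; apply/orP; left; apply/eqP; field.
have p01 (h : {set 'I_t}) : #|h| = d.+1 -> 0 <= p h <= 1.
  by move=> /pe/andP[a1 ->]; rewrite (le_trans (ltW e0) a1).
have S1d phi (pS : phi \in S1) := (S1P phi pS).2.
have := avg_cell_extend lP S0d S1d restrS0 p01 lg dec r0 rg bth.
have NL2 : (#|N| <= (L + L).+1)%N by rewrite -addnS; exact: leq_trans (leq_addr _ _).
have := IH _ _ NL2 clS0 S0d.
rewrite -S01 -/Pi0 -/Pi1; set C0 := avg _; set C := avg _ => C0le Cle.
have -> : \prod_(phi in S) p (dom phi) = Pi1 * Pi0.
  rewrite (big_setID S0) /= mulrC; congr (_ * _); rewrite /Pi0.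
  by have -> : S :&: S0 = S0 by apply/setP => phi; rewrite !inE; case: (phi \in S).
have S1K : (#|S1|%:R : R) <= K%:R.
  by rewrite ler_nat; apply: leq_trans (KP _ NL); exact: max_card.
have eK0 : 0 <= eta ^+ K by rewrite exprn_ge0 // ltW.
have tau0 : 0 <= tau by move: t0 tt; clear; lra.
have h1 : #|S1|%:R * (reg + kappa * Pi0) <= tau / 2 * (Pi1 * Pi0).
  apply: le_trans (_ : K%:R * (reg + kappa * Pi0) <= _).
    by rewrite ler_wpM2r // addr_ge0 // mulr_ge0.
  have e2 : eta ^+ K * delta ^+ K <= Pi1 * Pi0.
    by apply: ler_pM => //; rewrite exprn_ge0 // ltW.
  have e3 : eta ^+ K * Pi0 <= Pi1 * Pi0 by rewrite ler_wpM2r.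
  have e4 : K%:R * kappa * Pi0 <= tau / 4 * eta ^+ K * Pi0 by rewrite ler_wpM2r.
  have e5 : tau / 4 * (eta ^+ K * delta ^+ K) <= tau / 4 * (Pi1 * Pi0).
    by rewrite ler_wpM2l // divr_ge0.
  have e6 : tau / 4 * (eta ^+ K * Pi0) <= tau / 4 * (Pi1 * Pi0).
    by rewrite ler_wpM2l // divr_ge0.
  have -> : K%:R * (reg + kappa * Pi0) = K%:R * reg + K%:R * kappa * Pi0 by ring.
  have -> : tau / 2 * (Pi1 * Pi0) = tau / 4 * (Pi1 * Pi0) + tau / 4 * (Pi1 * Pi0).
    by field.
  rewrite lerD ?(le_trans Kr e5) // (le_trans e4) // -mulrA.
  exact: e6.
have Pi10 : 0 <= Pi1 by exact: le_trans Pi1K.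
have h2 : `|Pi1 * C0 - Pi1 * Pi0| <= tau / 2 * (Pi1 * Pi0).
  rewrite -mulrBr normrM (ger0_norm Pi10).
  apply: le_trans (_ : Pi1 * (tau' * Pi0) <= _); first by rewrite ler_wpM2l.
  by rewrite mulrCA ler_wpM2r // mulr_ge0.
have -> : C - Pi1 * Pi0 = (C - Pi1 * C0) + (Pi1 * C0 - Pi1 * Pi0) by ring.
apply: le_trans (ler_normD _ _) _.
have -> : tau * (Pi1 * Pi0) = tau / 2 * (Pi1 * Pi0) + tau / 2 * (Pi1 * Pi0).
  by field.
by rewrite lerD // (le_trans Cle h1).
Qed.

End Counting.

(** * Induction on the dimension, and the removal lemma *)

Section Removal.
Variables (R : archiRealFieldType) (t : nat).

(** [delta] is chosen before [V], hence uniform in the number of vertices. [P] keeps the colours of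
    the [d]-faces and may change all others. The exceptional tuples are marked by local events, one
    for each face, so that they can later be charged to [k]-tuples. *)
Definition counting (d : nat) : Prop :=
  forall (m L : nat) (eps tau : R), 0 < eps -> 0 < tau ->
  exists2 delta : R, 0 < delta &
  forall (V : finType) (Q : {set 'I_t} -> {ffun 'I_t -> V} -> nat),
  (0 < #|V|)%N -> (forall h, local h (Q h)) -> (forall h x, (Q h x < m)%N) ->
  exists P (D : {set 'I_t} -> {ffun 'I_t -> V} -> bool),
  [/\ forall h, local h (P h),
      forall (h : {set 'I_t}) x, #|h| = d -> P h x = Q h x,
      forall h, local h (D h) /\ (forall x, D h x -> (#|h| <= d)%N),
      forall h, avg (fun x => (D h x)%:R) <= eps &
      forall x, (forall h, ~~ D h x) ->
      exists2 p : {set 'I_t} -> R, (forall h, delta <= p h) &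
      forall (N : finType) (S : {set face t N}), (#|N| <= L)%N -> closed S ->
      (forall phi, phi \in S -> (#|dom phi| <= d)%N) ->
      `|avg (fun y => (cell P S x y)%:R) - \prod_(phi in S) p (dom phi)|
        <= tau * \prod_(phi in S) p (dom phi)].

Lemma counting0 : counting 0.
Proof.
move=> m L eps tau eps0 tau0; exists 1 => // V Q V0 lQ Qm.
exists Q, (fun _ _ => false); split => //.
  by move=> h; apply: ler_avg_cst => [|x]; exact: ltW.
move=> x _; exists (fun _ => 1) => // N S NL clS Sd.
rewrite big1 // mulr1.
have -> : avg (fun y => (cell Q S x y)%:R) = 1 :> R.
  rewrite -[RHS](@avg_cst _ {ffun N -> {ffun 'I_t -> V}}); last first.
    by apply/card_gt0P; exists [ffun _ => x].
  apply: eq_avg => y; have -> // : cell Q S x y.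
  apply/forall_inP => phi pS; apply/eqP/lQ => j.
  by have := Sd _ pS; rewrite leqn0 cards_eq0 => /eqP ->; rewrite inE.
by rewrite subrr normr0 ltW.
Qed.

Lemma pos_lower_bound (f : nat -> R) n : (forall M, 0 < f M) ->
  exists2 c, 0 < c & forall M, (M <= n)%N -> c <= f M.
Proof.
move=> f0; elim: n => [|n [c c0 cf]].
  by exists (f 0%N) => // M; rewrite leqn0 => /eqP ->.
exists (Num.min c (f n.+1)); first by rewrite lt_min c0 f0.
move=> M; rewrite leq_eqVlt ltnS => /orP[/eqP ->|/cf cM].
  by rewrite ge_min lexx orbT.
by rewrite ge_min cM.
Qed.

(** Conditioning on the boundary, each of the [m] colours contributes at most [eta] where its
    density is below [eta]. *)
Lemma avg_low_density (V : finType) d m Q P (h : {set 'I_t}) (eta : R) :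
  0 <= eta -> (forall x : {ffun 'I_t -> V}, (Q h x < m)%N) ->
  avg (fun x => (density R d Q P h (Q h x) x < eta)%R%:R) <= m%:R * eta :> R.
Proof.
move=> eta0 Qm.
have -> : avg (fun x => (density R d Q P h (Q h x) x < eta)%R%:R)
  = \sum_(c < m) avg (fun x =>
      indic R Q h c x * (density R d Q P h c x < eta)%R%:R).
  rewrite -avg_sum; apply: eq_avg => x.
  rewrite (bigD1 (Ordinal (Qm x))) //= /indic eqxx mul1r big1 ?addr0 // => c.
  by rewrite -val_eqE /= eq_sym => /negPf ->; rewrite mul0r.
apply: le_trans (_ : \sum_(c < m) eta <= _); last first.
  by rewrite sumr_const card_ord mulr_natl.
apply: ler_sum => c _.
rewrite -(@avg_cexpM _ _ _ (boundary_key d P h)); last first.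
  by move=> x y e; rewrite /density (cexp_key _ e).
apply: ler_avg_cst => // x; rewrite -/(density R d Q P h c x).
by case: ltP => [/ltW|_]; rewrite ?mulr1 ?mulr0.
Qed.

(** The relation [lower] as equality of keys, so that one can condition on it. *)
Definition lower_key (V : finType) (P : {set 'I_t} -> {ffun 'I_t -> V} -> nat)
    (h : {set 'I_t}) x : {ffun {set 'I_t} -> nat} :=
  [ffun f : {set 'I_t} => if f \proper h then P f x else 0%N].

Lemma lower_keyP (V : finType) (P : {set 'I_t} -> {ffun 'I_t -> V} -> nat) h x z :
  (lower_key P h z == lower_key P h x) = lower P h x z.
Proof.
apply/eqP/forallP => [/ffunP e f|e].
  by apply/implyP => fh; have := e f; rewrite !ffunE fh => ->.
apply/ffunP => f; rewrite !ffunE; case: ifP => // fh.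
by apply/eqP; have := e f; rewrite fh.
Qed.

(** The order of choices matters: [eta], [kappa], [alpha], [eps1] and [tau'] come first; the
    induction hypothesis then gives [delta M] for [M] colours, and [reg M] is chosen against it.
    Strong regularity yields [P0] and [P'], and induction is applied to the coarse [P0] only, so no
    constant depends on the number of colours of [P']. *)
Lemma countingS d : counting d -> counting d.+1.
Proof.
move=> Cd m L eps tau eps0 tau0.
pose K := ((L.+1) ^ t)%N.
have KP (N : finType) : (#|N| <= L -> #|{: face t N}| <= K)%N.
  move=> NL; rewrite card_ffun card_ord card_option /K.
  by case: (posnP t) => [->|t0]; rewrite ?expn0 ?leq_exp2r.
pose e3 := eps / 3; have e30 : 0 < e3 by rewrite divr_gt0.
(* Chosen so that tuples of low density have measure at most [e3]; [m.+1] avoids dividing by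
   zero. *)
pose eta := Num.min (e3 / m.+1%:R) 1.
have eta0 : 0 < eta by rewrite lt_min ltr01 divr_gt0 ?ltr0n.
have eta1 : eta <= 1 by rewrite ge_min lexx orbT.
have etaK : 0 < eta ^+ K by rewrite exprn_gt0.
pose kappa := tau / 4 * eta ^+ K / K.+1%:R.
have kappa0 : 0 < kappa by rewrite divr_gt0 ?ltr0n // mulr_gt0 // divr_gt0.
pose alpha := kappa ^+ 2 / 4.
have alpha0 : 0 < alpha by rewrite divr_gt0 // exprn_gt0.
(* Markov's inequality at level [alpha] turns [m] mean squares of size [eps1] into a measure of at
   most [e3]. *)
pose eps1 := alpha * e3 / m.+1%:R.
have eps10 : 0 < eps1 by rewrite divr_gt0 ?ltr0n // mulr_gt0.
pose tau' := Num.min (tau / 2) 1.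
have tau'0 : 0 < tau' by rewrite lt_min ltr01 divr_gt0.
have [delta deltaP] := boolp.choice (fun M =>
  (boolp.exists2P _ _).1 (Cd M (L + L).+1 e3 tau' e30 tau'0)).
pose dl M := Num.min (delta M) 1.
have dl0 M : 0 < dl M by rewrite lt_min ltr01; case: (deltaP M) => ->.
pose reg M := tau / 4 * (eta ^+ K * dl M ^+ K) / K.+1%:R.
have reg0 M : 0 < reg M.
  by rewrite divr_gt0 ?ltr0n // !mulr_gt0 ?exprn_gt0 // invr_gt0.
have [Mmax MmaxP] := regularity t d m eps10 reg0.
have [c c0 cP] := pos_lower_bound Mmax dl0.
exists (Num.min eta c); first by rewrite lt_min eta0.
move=> V Q V0 lQ Qm.
have [M [P0 [P' [MM [lP0 P0M] lP' rg gap]]]] := MmaxP V Q.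
have [_ /(_ V P0 V0 lP0 P0M) [P1 [D1 [lP1 P1E lD1 D1e cP1]]]] := deltaP M.
pose P (h : {set 'I_t}) := if #|h| == d.+1 then Q h else P1 h.
pose b (h : {set 'I_t}) c z := density R d Q P' h c z - density R d Q P0 h c z.
pose B h z := \sum_(c < m) b h c z ^+ 2.
(* Two new exceptions in the top dimension: the colour of [x] is too rare, or the gap between fine
   and coarse densities is large in mean square on the lower cell of [x]. *)
pose D2 h x := density R d Q P0 h (Q h x) x < eta.
pose D3 h x := alpha < cexp (lower_key P1 h) (B h) x.
pose D (h : {set 'I_t}) x := D1 h x || ((#|h| == d.+1) && (D2 h x || D3 h x)).
have lP h : local h (P h) by rewrite /P; case: ifP.
have lkey (h : {set 'I_t}) (x y : {ffun 'I_t -> V}) :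
    {in h, x =1 y} -> lower_key P1 h x = lower_key P1 h y.
  move=> xy; apply/eqP; rewrite lower_keyP; apply/forallP => f.
  apply/implyP => fh; apply/eqP/lP1 => j jf; apply: xy.
  exact: (subsetP (proper_sub fh)).
have B0 h z : 0 <= B h z by apply: sumr_ge0 => i _; exact: sqr_ge0.
exists P, D; split => //.
- by move=> h x hd; rewrite /P hd eqxx.
- move=> h; split=> [x y xy|x]; last first.
    by rewrite /D => /orP[/(lD1 h).2/leqW//|/andP[/eqP -> _]].
  rewrite /D ((lD1 h).1 x y) //; case: eqP => //= hd.
  rewrite /D2 /D3 (lQ h x y) // (@density_local R t V d Q P0 h _ lP0 x y xy).
  by rewrite (cexp_key _ (lkey h x y xy)).
- move=> h; apply: le_trans (_ : avg (fun x =>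
    (D1 h x)%:R + (D2 h x)%:R + (D3 h x)%:R) <= _).
    apply: ler_avg => x; rewrite /D -!natrD ler_nat.
    by case: (D1 h x); case: (D2 h x); case: (D3 h x); case: (#|h| == d.+1).
  rewrite !avgD.
  have b1 := D1e h.
  have b2 : avg (fun x => (D2 h x)%:R) <= e3 :> R.
    apply: le_trans (avg_low_density d P0 (ltW eta0) (Qm h)) _.
    apply: le_trans (_ : m%:R * (e3 / m.+1%:R) <= _).
      by rewrite ler_wpM2l // ge_min lexx.
    rewrite mulrCA ler_piMr ?(ltW e30) // ler_pdivrMr ?ltr0n // mul1r ler_nat.
    exact: leqnSn.
  have b3 : avg (fun x => (D3 h x)%:R) <= e3 :> R.
    apply: le_trans (avg_markov alpha0 _) _.
      by move=> x; apply: cexp_ge0.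
    rewrite avg_cexp ler_pdivrMr // avg_sum.
    apply: le_trans (_ : \sum_(i < m) eps1 <= _).
      by apply: ler_sum => i _; exact: gap.
    rewrite sumr_const card_ord -mulr_natl /eps1 mulrA ler_pdivrMr ?ltr0n //.
    rewrite (mulrC e3) [leRHS]mulrC ler_wpM2r ?ler_nat ?leqnSn // ltW //.
    exact: mulr_gt0.
  have -> : eps = e3 + e3 + e3 by rewrite /e3; field.
  by rewrite !lerD.
move=> x Dx.
have [|p dp pP] := cP1 x.
  by move=> h; have := Dx h; rewrite negb_or => /andP[].
pose q (h : {set 'I_t}) :=
  if #|h| == d.+1 then density R d Q P0 h (Q h x) x else p h.
have dle : dl M <= delta M by rewrite ge_min lexx.
have qle h : Num.min eta c <= q h.
  rewrite /q; case: ifP => hd; rewrite ge_min.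
    by have := Dx h; rewrite /D hd /= !negb_or -!leNgt => /and3P[_ -> _].
  by rewrite (le_trans (cP _ MM)) ?orbT // (le_trans dle).
exists q => //.
pose g (h : {set 'I_t}) z :=
  indic R Q h (Q h x) z - density R d Q P' h (Q h x) z.
have PE (f : {set 'I_t}) : (#|f| <= d)%N -> P f = P1 f.
  by rewrite /P; case: eqP => // ->; rewrite ltnn.
have lowE (h : {set 'I_t}) z : #|h| = d.+1 -> lower P h x z = lower P1 h x z.
  move=> hd; apply: eq_forallb => f; case: (boolP (f \proper h)) => // fh.
  by rewrite PE // -ltnS -hd proper_card.
(* [P1] and [P0] agree on [d]-faces, so on the lower cell of [x] the coarse density is constant,
   equal to [q h]. *)
have lowkey (h : {set 'I_t}) z : #|h| = d.+1 -> lower P h x z ->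
    boundary_key d P0 h z = boundary_key d P0 h x.
  move=> hd low; apply/boundary_keyP => f fh fd.
  have fp : f \proper h by rewrite properEcard fh fd hd ltnS leqnn.
  move: low => /forallP/(_ f); rewrite fp /= PE ?fd // => /eqP.
  by rewrite !P1E.
apply: (@cell_count_step _ _ V d L K P x q (fun h => b h (Q h x)) g (dl M) eta
  kappa (reg M) tau tau') => //.
- by rewrite dl0 ge_min lexx orbT.
- by rewrite eta0.
- exact: ltW.
- exact: ltW.
- by rewrite ltW //= ge_min lexx orbT.
- by rewrite ge_min lexx.
- rewrite /kappa mulrA ler_pdivrMr ?ltr0n // mulrC ler_wpM2l ?ler_nat ?leqnSn //.
  by rewrite ltW // mulr_gt0 // divr_gt0.
- rewrite /reg mulrA ler_pdivrMr ?ltr0n // mulrC ler_wpM2l ?ler_nat ?leqnSn //.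
  by rewrite ltW // !mulr_gt0 ?exprn_gt0 // invr_gt0.
- move=> h hd; rewrite /q; case: eqP => [hd'|_]; last exact: le_trans dle _.
  by rewrite hd' ltnn in hd.
- move=> h hd; rewrite /q hd eqxx density_le1 andbT.
  by have := Dx h; rewrite /D hd eqxx /= !negb_or -!leNgt => /and3P[].
- move=> h hd y z yz; rewrite /b.
  rewrite (@density_local R t V d Q P0 h _ lP0 y z yz).
  by rewrite (@density_local R t V d Q P' h _ lP' y z yz).
- move=> h hd y z yz; rewrite /g /indic (lQ h y z yz).
  by rewrite (@density_local R t V d Q P' h _ lP' y z yz).
- move=> h z hd low; rewrite /P hd eqxx /q hd eqxx /b /g.
  rewrite /density (cexp_key _ (lowkey h z hd low)) -/(indic R Q h (Q h x) z).
  by ring.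
- by move=> h U hd lU; apply: rg.
- move=> h hd.
  have := Dx h; rewrite /D hd eqxx /= !negb_or -!leNgt => /and3P[_ _ D3x].
  have := avg_fiber_le D3x.
  under eq_avg do rewrite lower_keyP -lowE //.
  under [X in _ <= _ * X -> _]eq_avg do rewrite lower_keyP -lowE //.
  apply: le_trans; apply: ler_avg => z; rewrite ler_wpM2l // /B.
  rewrite (bigD1 (Ordinal (Qm h x))) //= lerDl.
  by apply: sumr_ge0 => i _; exact: sqr_ge0.
- move=> N S NL clS Sd.
  have e1 : \prod_(phi in S) q (dom phi) = \prod_(phi in S) p (dom phi).
    apply: eq_bigr => phi pS; rewrite /q; case: eqP => // hd.
    by have := Sd _ pS; rewrite hd ltnn.
  have e2 y : cell P S x y = cell P1 S x y.
    by apply: eq_forallb_in => phi pS; rewrite PE // Sd.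
  by under eq_avg do rewrite e2; rewrite e1; exact: pP.
Qed.

Lemma counting_lemma d : counting d.
Proof. by elim: d => [|d]; [exact: counting0|exact: countingS]. Qed.

Lemma avg_unit (X : finType) (G : X -> R) :
  avg (fun y : {ffun unit -> X} => G (y tt)) = avg G.
Proof.
rewrite (@avg_bij _ _ _ (fun y : {ffun unit -> X} => y tt) G) //.
exists (fun z => [ffun _ => z]) => [y|z]; last by rewrite ffunE.
by apply/ffunP => -[]; rewrite ffunE.
Qed.

(** Counting is applied to one copy of each coordinate with all faces of size at most [k]. A
    relative error of one half leaves half a product of boundedly many factors, each at least
    [c1]. *)
Lemma hypergraph_removal (k m : nat) (eps : R) : 0 < eps ->
  exists2 delta : R, 0 < delta &
  forall (V : finType) (Q : {set 'I_t} -> {ffun 'I_t -> V} -> nat),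
  (0 < #|V|)%N -> (forall h, local h (Q h)) -> (forall h x, (Q h x < m)%N) ->
  exists D : {set 'I_t} -> {ffun 'I_t -> V} -> bool,
  [/\ forall h, local h (D h),
      forall h, avg (fun x => (D h x)%:R) <= eps,
      forall (h : {set 'I_t}) x, D h x -> (#|h| <= k)%N &
      forall x, (forall h, ~~ D h x) ->
      delta <= avg (fun z =>
        [forall h : {set 'I_t}, (#|h| == k) ==> (Q h z == Q h x)]%:R :> R)].
Proof.
move=> eps0; have half0 : 0 < 2^-1 :> R by rewrite invr_gt0.
have [c c0 cP] := counting_lemma k m 1 eps0 half0.
pose c1 := Num.min c 1.
have c10 : 0 < c1 by rewrite lt_min c0 ltr01.
exists (2^-1 * c1 ^+ #|{: face t unit}|); first by rewrite mulr_gt0 ?exprn_gt0.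
move=> V Q V0 lQ Qm; have [P [D [lP PQ lD De DP]]] := cP V Q V0 lQ Qm.
exists D; split => //; [by move=> h; case: (lD h)|by move=> h; case: (lD h)|].
move=> x /DP[p pc pP].
pose S := [set psi : face t unit | #|dom psi| <= k]%N.
have clS : closed S.
  move=> h psi; rewrite !inE dom_restr; apply: leq_trans.
  by rewrite subset_leq_card // subsetIr.
have Sk psi : psi \in S -> (#|dom psi| <= k)%N by rewrite inE.
have := pP _ S _ clS Sk; rewrite card_unit => /(_ isT).
set Pi := \prod_(_ in S) _; set C := avg _ => CPi.
have PiK : c1 ^+ #|{: face t unit}| <= Pi.
  apply: ler_prod_exp; last by move=> psi _; rewrite ge_min pc.
    by rewrite (ltW c10) ge_min lexx orbT.
  exact: max_card.
have C2 : 2^-1 * Pi <= C.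
  by move: CPi; rewrite ler_norml => /andP[+ _]; move: Pi C {PiK} => u v; lra.
apply: le_trans (_ : 2^-1 * Pi <= _); first by rewrite ler_pM2l.
apply: le_trans C2 _; rewrite -avg_unit; apply: ler_avg => y.
case E: (cell P S x y); last by rewrite ler0n.
suff -> : [forall h : {set 'I_t}, (#|h| == k) ==> (Q h (y tt) == Q h x)] by [].
apply/forallP => h; apply/implyP => /eqP hk.
pose psi : face t unit := [ffun j => if j \in h then Some tt else None].
have domp : dom psi = h by apply/setP => j; rewrite inE ffunE; case: ifP.
move/forall_inP: E => /(_ psi); rewrite inE domp hk leqnn !PQ // => /(_ isT).
congr (_ == _); apply: lQ => j jh; by rewrite !ffunE jh.
Qed.

End Removal.

(** * Sparse hypergraphs *)

Section Combinatorics.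
Implicit Type T : finType.

Lemma subset_of_card T (B : {set T}) k :
  (k <= #|B|)%N -> exists2 A : {set T}, A \subset B & #|A| = k.
Proof.
rewrite -bin_gt0 -cards_draws => /card_gt0P[A].
by rewrite inE => /andP[AB /eqP Ak]; exists A.
Qed.

Lemma superset_of_card T (A : {set T}) k : (#|A| <= k <= #|T|)%N ->
  exists2 B : {set T}, A \subset B & #|B| = k.
Proof.
move=> /andP[Ak kT].
have [|C CA Ck] := @subset_of_card _ (~: A) (k - #|A|).
  by rewrite (cardsCs (~: A)) setCK leq_sub2r.
exists (A :|: C); first exact: subsetUl.
rewrite cardsU (_ : A :&: C = set0) ?cards0 ?subn0 ?Ck ?subnKC //.
by apply/eqP; rewrite setI_eq0 disjoint_sym disjoints_subset.
Qed.

Lemma card_setU_cover T (A : {set T}) (E : {set {set T}}) s :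
  (forall B, B \in E -> #|B :\: A| <= s)%N ->
  (#|A :|: cover E| <= #|A| + #|E| * s)%N.
Proof.
move=> Es.
have [n] := ubnP #|E|; elim: n E Es => // n IHn E Es.
have [->|[B BE]] := set_0Vmem E.
  by rewrite /cover big_set0 setU0 cards0 addn0.
rewrite (cardsD1 B) BE add1n ltnS => En; have := IHn (E :\ B) _ En.
move=> /(_ (fun C CE => Es C (subsetP (subsetDl _ _) _ CE))) le.
have -> : A :|: cover E = (A :|: cover (E :\ B)) :|: (B :\: A).
  rewrite /cover (big_setD1 B) //=; apply/setP => x; rewrite !inE.
  by case: (x \in A); rewrite //= orbC.
rewrite mulSn addnCA addnC; apply: leq_trans (leq_add le (Es _ BE)).
by rewrite cardsU leq_subr.
Qed.

(** Take a maximal subfamily with small intersections: the neighbourhoods [N A] of its members cover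
    [H]. If some [N A] had more than [e] members, [A] and [e.-1] others would span at most
    [r + e.-1 * (r - k)] vertices. *)
Lemma edge_packing T (r k v e : nat) (H : {set {set T}}) :
  (0 < e)%N -> (r + e.-1 * (r - k) <= v)%N ->
  uniform_hypergraph r H -> G_free v e H ->
  exists H' : {set {set T}}, [/\ H' \subset H,
    forall A B, A \in H' -> B \in H' -> (k <= #|A :&: B|)%N -> A = B &
    (#|H| <= #|H'| * e)%N].
Proof.
move=> e0 rv /forall_inP Hr Hfree.
pose packed (F : {set {set T}}) := (F \subset H) &&
  [forall A in F, forall B in F, (k <= #|A :&: B|)%N ==> (A == B)].
have p0 : packed set0.
  by rewrite /packed sub0set; apply/forall_inP => A; rewrite inE.
have [H' /maxsetP[/andP[H'H pack] maxH'] _] := maxset_exists p0.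
have packP A B : A \in H' -> B \in H' -> (k <= #|A :&: B|)%N -> A = B.
  move=> AH BH kAB; move/forall_inP: pack => /(_ A AH) /forall_inP /(_ B BH).
  by rewrite kAB => /eqP.
exists H'; split => //.
pose N A := [set B in H | (A == B) || (k <= #|A :&: B|)%N].
have NA A : A \in H' -> (#|N A| <= e)%N.
  move=> AH'; have AH := subsetP H'H _ AH'; rewrite leqNgt; apply/negP => big.
  have AN : A \in N A by rewrite inE AH eqxx.
  have [|F FN Fe] := @subset_of_card _ (N A :\ A) e.-1.
    by move: big; rewrite (cardsD1 A) AN add1n ltnS; apply: leq_trans; exact: leq_pred.
  move/existsPn: Hfree => /(_ (A |: F)) /negP; apply; apply/and3P.
  have FP B : B \in F -> [/\ B \in H, A != B & (k <= #|A :&: B|)%N].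
    move=> /(subsetP FN); rewrite !inE eq_sym => /andP[AB /andP[BH]].
    by rewrite (negPf AB).
  have AF : A \notin F by apply/negP => /FP[_]; rewrite eqxx.
  split.
  - apply/subsetP => B; rewrite !inE => /orP[/eqP -> //|/FP[]//].
  - by rewrite cardsU1 AF Fe add1n prednK.
  - have -> : cover (A |: F) = A :|: cover F.
      by rewrite /cover bigcup_setU big_set1.
    apply: leq_trans rv; rewrite -{1}(eqP (Hr _ AH)) -Fe; apply: card_setU_cover.
    move=> B /FP[BH AB kAB]; rewrite cardsD (eqP (Hr _ BH)).
    by apply: leq_sub2l; rewrite setIC.
have Hsub : H \subset \bigcup_(A in H') N A.
  apply/subsetP => B BH; apply/bigcupP.
  have [BH'|BH'] := boolP (B \in H').
    by exists B => //; rewrite inE BH eqxx.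
  have : ~~ packed (B |: H').
    apply/negP => pB; have := maxH' _ pB (subsetUr _ _).
    by move=> eB; rewrite -eB setU11 in BH'.
  rewrite /packed subUset sub1set BH H'H /= => /forall_inPn[A AB].
  move=> /forall_inPn[C CB]; rewrite negb_imply => /andP[kAC AC].
  move: AB CB; rewrite !inE => /orP[/eqP eA|AH'] /orP[/eqP eC|CH'].
  - by rewrite eA eC eqxx in AC.
  - by exists C => //; rewrite inE BH -eA setIC kAC orbT.
  - by exists A => //; rewrite inE BH -eC kAC orbT.
  - by rewrite (packP _ _ AH' CH' kAC) eqxx in AC.
apply: leq_trans (subset_leq_card Hsub) _.
rewrite -sum_nat_const.
elim/big_rec2: _ => [|A m F AH' Fm]; first by rewrite cards0.
by apply: leq_trans (leq_add (NA _ AH') Fm); rewrite cardsU leq_subr.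
Qed.

End Combinatorics.

(** * Probabilities of boxes *)

Section Boxes.
Variables (R : archiRealFieldType) (t : nat) (V : finType).

Lemma avg_prod (F : 'I_t -> V -> R) :
  avg (fun y : {ffun 'I_t -> V} => \prod_j F j (y j)) = \prod_j avg (F j).
Proof.
rewrite /avg -bigA_distr_bigA big_split /=; congr (_ * _).
by rewrite prodr_const card_ffun card_ord natrX exprVn.
Qed.

Lemma avg_box (h : {set 'I_t}) (B : 'I_t -> {set V}) s : (0 < #|V|)%N ->
  (forall j, j \in h -> #|B j| = s) ->
  avg (fun y : {ffun 'I_t -> V} => [forall j in h, y j \in B j]%:R)
  = (s%:R / #|V|%:R) ^+ #|h| :> R.
Proof.
move=> V0 Bs.
transitivity (avg (fun y : {ffun 'I_t -> V} =>
    \prod_j (if j \in h then (y j \in B j)%:R else 1 : R))).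
  apply: eq_avg => y; rewrite -big_mkcond /=.
  have [/forall_inP yB|/forall_inPn[j jh jB]] :=
    boolP [forall j in h, y j \in B j].
    by rewrite big1 // => j /yB ->.
  by rewrite (bigD1 j) //= (negPf jB) mul0r.
rewrite (avg_prod (fun j v => if j \in h then (v \in B j)%:R else 1)).
rewrite (bigID (mem h)) /= [X in _ * X]big1 ?mulr1 => [|j /negPf ->]; last first.
  by rewrite avg_cst.
rewrite -prodr_const; apply: eq_bigr => j jh; rewrite jh /avg; congr (_ / _).
rewrite -(Bs _ jh) -sum1_card natr_sum [RHS]big_mkcond.
by apply: eq_bigr => v _; case: (v \in B j).
Qed.

End Boxes.

(** * Tuples compatible with the labelled edges of a packed hypergraph *)

Section Hypergraphs.
Variables (R : archiRealFieldType) (t n k r : nat).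
Variables (H : {set {set 'I_n}}) (xi : {set 'I_n} -> {ffun 'I_t -> 'I_n}).
Hypothesis n0 : (0 < n)%N.
Hypothesis kt : (k <= t)%N.
Hypothesis xi_in : forall A j, A \in H -> xi A j \in A.
Hypothesis xi_inj : forall A, A \in H -> injective (xi A).
Hypothesis H_packed : forall A B, A \in H -> B \in H ->
  (k <= #|A :&: B|)%N -> A = B.

(** Singletons make this a box of side 1, as [avg_box] expects. *)
Definition agree (A : {set 'I_n}) (h : {set 'I_t}) (y : {ffun 'I_t -> 'I_n}) :=
  [forall j in h, y j \in [set xi A j]].

Lemma agree_uniq A B (h : {set 'I_t}) y : A \in H -> B \in H -> (k <= #|h|)%N ->
  agree A h y -> agree B h y -> A = B.
Proof.
move=> AH BH kh /forall_inP yA /forall_inP yB; apply: H_packed => //.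
apply: leq_trans kh _; rewrite -(card_imset _ (xi_inj AH)) subset_leq_card //.
apply/subsetP => v /imsetP[j jh ->]; rewrite inE xi_in //=.
have := yA j jh; rewrite inE => /eqP <-.
by have := yB j jh; rewrite inE => /eqP ->; exact: xi_in.
Qed.

(** Extend [h] to a [k]-set [g]. The tuples agreeing with [xi A] on [g] have density [n ^- k]; for
    distinct [A] these sets are disjoint by packing, and by locality they lie in [D]. *)
Lemma card_marked (D : {ffun 'I_t -> 'I_n} -> bool) (h : {set 'I_t})
    (F : {set {set 'I_n}}) :
  local h D -> (#|h| <= k)%N -> F \subset H -> (forall A, A \in F -> D (xi A)) ->
  #|F|%:R <= n%:R ^+ k * avg (fun y => (D y)%:R) :> R.
Proof.
move=> lD hk FH DF.
have [|g hg gk] := @superset_of_card _ h k; first by rewrite hk card_ord.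
rewrite mulrC -ler_pdivrMr ?exprn_gt0 ?ltr0n //.
apply: le_trans (_ : avg (fun y => \sum_(A in F) (agree A g y)%:R) <= _).
  rewrite avg_sum (eq_bigr (fun _ => (n%:R ^+ k)^-1)).
    by rewrite sumr_const -(mulr_natl (_^-1)).
  move=> A AF; rewrite /agree (@avg_box _ _ _ g _ 1).
  - by rewrite card_ord gk mul1r exprVn.
  - by rewrite card_ord.
  - by move=> j _; rewrite cards1.
apply: ler_avg => y.
have [/exists_inP[A AF yA]|/exists_inPn nA] := boolP [exists A in F, agree A g y].
  rewrite (bigD1 A) //= big1 ?addr0 => [|B /andP[BF]].
    rewrite yA (lD y (xi A)) ?DF // => j jh.
    by move/forall_inP: yA => /(_ j (subsetP hg _ jh)); rewrite inE => /eqP.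
  apply: contraNeq => nB; apply/eqP.
  apply: (@agree_uniq _ _ g y); rewrite ?(subsetP FH) ?gk //.
  by move: nB; case: (agree B g y) => //; rewrite eqxx.
by rewrite big1 ?ler0n // => A /nA /negPf ->.
Qed.

Lemma card_packed : (#|H| <= n ^ k)%N.
Proof.
rewrite -(ler_nat R) natrX.
have := @card_marked xpredT set0 H (fun _ _ _ => erefl) _ (subxx _)
          (fun _ _ => isT).
by rewrite cards0 avg_cst ?mulr1 ?card_ffun ?card_ord ?expn_gt0 ?n0 //; apply.
Qed.

(** Union bound over at most [n ^ k] edges and [2 ^ t] sets [g], each event having probability
    [(r / n) ^ k.+1]. *)
Lemma avg_crowded : (forall A, A \in H -> #|A| = r) ->
  avg (fun y : {ffun 'I_t -> 'I_n} => [exists A in H,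
    [exists g : {set 'I_t}, (#|g| == k.+1) && [forall j in g, y j \in A]]]%:R)
  <= (2 ^ t * r ^ k.+1)%:R / n%:R :> R.
Proof.
move=> Hr.
apply: le_trans (_ : avg (fun y : {ffun 'I_t -> 'I_n} => \sum_(A in H)
   \sum_(g : {set 'I_t} | #|g| == k.+1) ([forall j in g, y j \in A]%:R : R)) <= _).
  apply: ler_avg => y.
  case: exists_inP => [[A AH /existsP[g /andP[gk yg]]]|_].
    rewrite (bigD1 A) //= (bigD1 g) //= yg -addrA lerDl addr_ge0 //.
      by apply: sumr_ge0 => *; rewrite ler0n.
    by apply: sumr_ge0 => *; apply: sumr_ge0 => *; rewrite ler0n.
  by apply: sumr_ge0 => *; apply: sumr_ge0 => *; rewrite ler0n.
pose q : R := (r%:R / n%:R) ^+ k.+1.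
have q0 : 0 <= q by rewrite exprn_ge0 // divr_ge0.
rewrite avg_sum.
apply: le_trans (_ : \sum_(A in H) (2 ^ t)%:R * q <= _).
  apply: ler_sum => A AH; rewrite avg_sum.
  rewrite (eq_bigr (fun _ => q)) => [|g /eqP gk]; last first.
    rewrite (@avg_box _ _ _ g _ r) ?card_ord ?gk // => j _; exact: Hr.
  rewrite sumr_const -(mulr_natl q) ler_wpM2r // ler_nat.
  apply: leq_trans (max_card _) _.
  by rewrite -cardsT -powersetT card_powerset cardsT card_ord.
rewrite sumr_const -(mulr_natl (_ * q)).
apply: le_trans (_ : (n ^ k)%:R * ((2 ^ t)%:R * q) <= _).
  by rewrite ler_wpM2r ?mulr_ge0 // ler_nat card_packed.
have n1 : n%:R != 0 :> R by rewrite pnatr_eq0 -lt0n.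
rewrite le_eqVlt; apply/orP; left; apply/eqP.
rewrite /q expr_div_n [n%:R ^+ _]exprS natrM !natrX.
by field; rewrite n1 expf_neq0.
Qed.

(* Every k-subset h of a crossing tuple y is covered by an edge; these edges are
   distinct as y is not crowded, and e of them span too few vertices. *)
Lemma crossing_tuple e (y : {ffun 'I_t -> 'I_n}) : (forall A, A \in H -> #|A| = r) ->
  (e <= 'C(t, k))%N -> G_free (t + e * (r - k)) e H ->
  (forall h : {set 'I_t}, #|h| = k -> exists2 A, A \in H & agree A h y) ->
  exists A (g : {set 'I_t}), [/\ A \in H, #|g| = k.+1 & forall j, j \in g -> y j \in A].
Proof.
move=> Hr ek Hfree cross; apply: boolp.contrapT => nc.
have /boolp.choice[Ah AhP] (h : {set 'I_t}) :
    exists A, #|h| = k -> A \in H /\ agree A h y.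
  have [hk|hk] := eqVneq #|h| k; last by exists set0 => /eqP; rewrite (negPf hk).
  by have [A AH yA] := cross h hk; exists A.
pose F := [set Ah h | h in [set h : {set 'I_t} | #|h| == k]].
have FH : F \subset H.
  by apply/subsetP => A /imsetP[h]; rewrite inE => /eqP /AhP[+ _] ->.
have inA (h : {set 'I_t}) j : #|h| = k -> j \in h -> y j = xi (Ah h) j.
  by move=> /AhP[_ /forall_inP yA] /yA; rewrite inE => /eqP.
have Fcard : #|F| = 'C(t, k).
  rewrite card_in_imset; first by rewrite card_draws card_ord.
  move=> h h'; rewrite !inE => /eqP hk /eqP hk' eA.
  apply/eqP; rewrite eq_sym eqEcard hk hk' leqnn andbT.
  (* An edge serving two distinct [k]-sets would contain [y] at [k.+1] coordinates. *)
  apply/subsetP => j jh'; apply: contraT => jh; case: nc.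
  have [AH _] := AhP h hk.
  exists (Ah h), (j |: h); split => //; first by rewrite cardsU1 jh hk.
  move=> l; rewrite !inE => /orP[/eqP ->|lh].
    by rewrite (inA h') // -eA xi_in.
  by rewrite (inA h) // xi_in.
have [|E EF Ee] := @subset_of_card _ F e; first by rewrite Fcard.
move/existsPn: Hfree => /(_ E) /negP; apply; apply/and3P; split.
- exact: subset_trans FH.
- by rewrite Ee.
(* At most [t] vertices come from [y]. Each edge adds at most [r - k], since it contains the [k]
   values of [y] on its set [h], distinct because the labelling is injective. *)
apply: leq_trans (_ : (#|(y @: setT) :|: cover E| <= _)%N).
  by rewrite subset_leq_card // subsetUr.
apply: leq_trans (_ : (#|y @: setT| + #|E| * (r - k) <= _)%N).
  apply: card_setU_cover => B /(subsetP EF) /imsetP[h]; rewrite inE => /eqP hk ->.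
  have [AH _] := AhP h hk.
  rewrite cardsD (Hr _ AH) leq_sub2l // -{1}hk -(card_imset _ (xi_inj AH)).
  rewrite subset_leq_card //; apply/subsetP => v /imsetP[j jh ->].
  by rewrite inE xi_in //= -(inA h) // imset_f.
rewrite Ee leq_add2r; apply: leq_trans (leq_imset_card _ _) _.
by rewrite cardsT card_ord.
Qed.

End Hypergraphs.

Lemma G_free_sub (T : finType) v e (H H' : {set {set T}}) :
  H' \subset H -> G_free v e H -> G_free v e H'.
Proof.
move=> HH; apply: contraNN => /existsP[E /and3P[EH Ee Ev]].
by apply/existsP; exists E; rewrite (subset_trans EH HH) Ee.
Qed.

Lemma edge_labelling (t n : nat) (A : {set 'I_n}) : (t <= #|A|)%N -> (0 < t)%N ->
  exists x : {ffun 'I_t -> 'I_n}, (forall j, x j \in A) /\ injective x.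
Proof.
move=> tA t0; have /card_gt0P[a _] : (0 < #|A|)%N by exact: leq_trans tA.
have jA (j : 'I_t) : (j < size (enum A))%N.
  by rewrite -cardE; apply: leq_trans tA.
exists [ffun j : 'I_t => nth a (enum A) j]; split.
  by move=> j; rewrite ffunE -mem_enum mem_nth.
move=> j j'; rewrite !ffunE => /eqP; rewrite nth_uniq ?enum_uniq //.
by move=> /eqP/val_inj.
Qed.

(** If every edge tuple is marked by some [D h], then [card_marked], summed over the [2 ^ t] sets
    [h], gives the bound. Otherwise an unmarked edge yields a density [delta] of crossing tuples,
    one of them uncrowded for large [n], against [crossing_tuple]. *)
Lemma card_packed_small (R : archiRealFieldType) (t k e r : nat) (c : R) :
  0 < c -> (k <= t <= r)%N -> (0 < t)%N -> (e <= 'C(t, k))%N ->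
  exists n0 : nat, forall n (H : {set {set 'I_n}}), (n0 <= n)%N ->
  (forall A, A \in H -> #|A| = r) ->
  (forall A B, A \in H -> B \in H -> (k <= #|A :&: B|)%N -> A = B) ->
  G_free (t + e * (r - k)) e H ->
  #|H|%:R <= c * n%:R ^+ k.
Proof.
move=> c0 /andP[kt tr] t0 ek.
pose eps := c / (2 ^ t)%:R.
have p0 : 0 < (2 ^ t)%:R :> R by rewrite ltr0n expn_gt0.
have eps0 : 0 < eps by rewrite divr_gt0.
have [delta delta0 removal] := hypergraph_removal t k 2 eps0.
(* Beyond [n0] the density of crowded tuples is below [delta]. *)
have [n0 n0P] := archi_mul (2 ^ t * r ^ k.+1)%:R delta0.
exists n0.+1 => n H n0n Hr Hpack Hfree.
have n_gt0 : (0 < n)%N by exact: leq_trans n0n.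
have /boolp.choice[xi xiP] (A : {set 'I_n}) : exists x : {ffun 'I_t -> 'I_n},
    A \in H -> (forall j, x j \in A) /\ injective x.
  have [AH|_] := boolP (A \in H); last by exists [ffun _ => Ordinal n_gt0].
  have [|x xP] := @edge_labelling t n A _ t0; first by rewrite Hr.
  by exists x.
have xi_in A j : A \in H -> xi A j \in A by move=> /xiP[].
have xi_inj A : A \in H -> injective (xi A) by move=> /xiP[].
pose Q (h : {set 'I_t}) y : nat := [exists A in H, agree xi A h y].
have lQ h : local h (Q h).
  move=> x y xy; congr nat_of_bool; apply: eq_existsb => A; congr (_ && _).
  by apply: eq_forallb_in => j jh; rewrite xy.
have [|h x|D [lD De Dk Dx]] := removal _ Q _ lQ; first by rewrite card_ord.
  exact: leq_b1.
have [/exists_inP[A AH /forallP DA]|/exists_inPn nD] :=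
  boolP [exists A in H, [forall h, ~~ D h (xi A)]]; last first.
  have Hsub : H \subset \bigcup_(h : {set 'I_t}) [set A in H | D h (xi A)].
    apply/subsetP => A AH; have /forallPn[h] := nD A AH; rewrite negbK => Dh.
    by apply/bigcupP; exists h; rewrite // inE AH.
  apply: le_trans (_ :
    (\sum_(h : {set 'I_t}) #|[set A in H | D h (xi A)]|)%:R <= _).
    rewrite ler_nat; apply: leq_trans (subset_leq_card Hsub) _.
    elim/big_rec2: _ => [|h m F _ Fm]; first by rewrite cards0.
    by apply: leq_trans (leq_add (leqnn _) Fm); rewrite cardsU leq_subr.
  rewrite natr_sum.
  apply: le_trans (_ : \sum_(h : {set 'I_t}) eps * n%:R ^+ k <= _); last first.
    rewrite sumr_const -[#|_|]/(#|{: {set 'I_t}}|) -cardsT -powersetT.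
    rewrite card_powerset cardsT card_ord -(mulr_natl (_ * _)) mulrA.
    by rewrite /eps mulrCA divff ?mulr1 // gt_eqF.
  apply: ler_sum => h _; have [hk|hk] := leqP #|h| k; last first.
    have -> : [set A in H | D h (xi A)] = set0.
      apply/setP => A; rewrite !inE; apply/negP => /andP[_ /Dk].
      by rewrite leqNgt hk.
    by rewrite cards0; apply: mulr_ge0; [exact: ltW|exact: exprn_ge0].
  apply: le_trans (_ : n%:R ^+ k * avg (fun y => (D h y)%:R) <= _).
    apply: (card_marked R n_gt0 kt xi_in xi_inj Hpack (lD h) hk).
      by apply/subsetP => A; rewrite inE => /andP[].
    by move=> A; rewrite inE => /andP[].
  by rewrite mulrC ler_wpM2r ?exprn_ge0.
(* An edge's own tuple has colour 1 on every face, so sharing its colours means being covered by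
   edges. *)
have Q1 h : Q h (xi A) = 1%N.
  rewrite /Q; suff -> : [exists B in H, agree xi B h (xi A)] by [].
  by apply/exists_inP; exists A => //; apply/forall_inP => j _; rewrite inE.
pose cross y := [forall h : {set 'I_t}, (#|h| == k) ==> (Q h y == Q h (xi A))].
pose crowded (y : {ffun 'I_t -> 'I_n}) := [exists A in H,
  [exists g : {set 'I_t}, (#|g| == k.+1) && [forall j in g, y j \in A]]].
have [y /andP[yc yn]] : exists y, cross y && ~~ crowded y.
  apply/existsP; apply: contraT; rewrite negb_exists => /forallP ny.
  have le : delta <= (2 ^ t * r ^ k.+1)%:R / n%:R.
    apply: le_trans (Dx _ DA) _.
    apply: le_trans (avg_crowded R n_gt0 kt xi_in xi_inj Hpack Hr).
    apply: ler_avg => y; rewrite -/(cross y) -/(crowded y) ler_nat.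
    by have := ny y; case: (cross y); case: (crowded y).
  move: le; rewrite ler_pdivlMr ?ltr0n // leNgt => /negP; case.
  apply: lt_le_trans n0P _; rewrite mulrC ler_pM2l // ler_nat.
  exact: ltnW.
have [|A' [g [A'H gk gA]]] :=
  @crossing_tuple _ _ _ _ H xi xi_in xi_inj e y Hr ek Hfree.
  move=> h hk; move/forallP: yc => /(_ h); rewrite hk eqxx Q1 /= /Q.
  by case: exists_inP => // -[B BH yB] _; exists B.
case/negP: yn; apply/exists_inP; exists A' => //; apply/existsP; exists g.
by rewrite gk eqxx; apply/forall_inP.
Qed.

(** Passing to a packed subfamily costs a factor [e], whence the constant [c / e]. *)
Lemma f_max_small (R : archiRealFieldType) (r k e i : nat) (c : R) :
  0 < c -> (k + i + 1 <= r)%N -> (e <= 'C(k + i + 1, k))%N -> (0 < e)%N ->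
  exists n0 : nat, forall n, (n0 <= n)%N ->
  (f_max r n (e * (r - k) + k + i + 1) e)%:R <= c * n%:R ^+ k.
Proof.
move=> c0 tr ek e0; have c10 : 0 < c / e%:R by rewrite divr_gt0 ?ltr0n.
have [||n0 n0P] := card_packed_small c10 _ _ ek (r := r).
- by rewrite tr -addnA leq_addr.
- by rewrite addn1.
exists n0 => n n0n; rewrite /f_max.
apply: (big_ind (fun m => m%:R <= c * n%:R ^+ k)).
- by rewrite mulr_ge0 ?exprn_ge0 // ltW.
- by move=> a b; rewrite /maxn; case: ifP.
move=> H /andP[Hu Hf].
have kr : (k <= r)%N by apply: leq_trans tr; rewrite -addnA leq_addr.
have [|H' [H'H pack cardH]] := edge_packing (k := k) e0 _ Hu Hf.
  (* [r + (e - 1)(r - k)] equals [e(r - k) + k], which leaves a slack of [i + 1] in the vertex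
     bound. *)
  case: e e0 {ek c10 n0P Hf} => // e _ /=; rewrite mulSn -!addnA.
  by rewrite addnCA [leqRHS]addnC -{1}(subnK kr); lia.
have Hr A : A \in H' -> #|A| = r.
  by move=> /(subsetP H'H) AH; move/forall_inP: Hu => /(_ A AH) /eqP.
have := n0P n H' n0n Hr pack.
rewrite (_ : (k + i + 1 + e * (r - k) = e * (r - k) + k + i + 1)%N); last first.
  by rewrite addnC !addnA.
move=> /(_ (G_free_sub H'H Hf)) le.
apply: le_trans (_ : (#|H'| * e)%:R <= _); first by rewrite ler_nat.
rewrite natrM -ler_pdivlMr ?ltr0n //; apply: le_trans le _.
by rewrite mulrAC.
Qed.

(* The asymptotic form *)
From mathcomp Require Import all_classical all_reals all_analysis.
Import numFieldNormedType.Exports.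
Local Open Scope classical_set_scope.

Theorem theorem2 (R : realType) (r k e i : nat)
    (hr : (k + i + 1 <= r)%N) (hki : (2 <= k + i + 1)%N)
    (hbin : (e <= 'C(k + i + 1, k))%N) (he : (3 <= e)%N) :
  (fun n : nat => (f_max r n (e * (r - k) + k + i + 1) e)%:R : R^o) =o_\oo
  (fun n : nat => n%:R ^+ k : R^o).
Proof.
apply/eqoP => c c0.
have [n0 n0P] := f_max_small (R := R) c0 hr hbin (ltnW (ltnW he)).
near=> n.
rewrite normr_nat normrX normr_nat; apply: n0P.
by near: n; exact: nbhs_infty_ge.
Unshelve. all: by end_near. Qed.
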